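(* There exist absolute constants $c>0$ and $C>0$ such that the following holds. Let $p$ be an odd prime, and let $G$ be a Chevalley group of classical type of rank $n$ over $K=\mathbb{Z}/p\mathbb{Z}$, i.e. one of $SL_{n+1}(K)$, $SO_{2n+1}(K)$, $Sp_{2n}(K)$ or $SO_{2n}(K)$. Let $U\subset G$ be the unipotent subgroup of the Borel subgroup, and let $\Sigma=\{\varepsilon_{\alpha_k}(1),\varepsilon_{\alpha_k}(-1): 1\le k\le n\}$ be the standard set of generators of $U$ coming from the simple root subgroups. Then the diameter of $U$ in $\Sigma$ satisfies $$c\,(np+n^2\log p)\ \le\ \operatorname{diam}(U,\Sigma)\ \le\ C\,(np+n^2\log p).$$
   Context: The diameter of a finite group $H$ with respect to a generating set $\Sigma$ is the least positive integer $N$ such that every element of $H$ can be written as a word of length at most $N$ in the elements of $\Sigma$. Explicit model. Let $N=n+1$ in type $A_n$ ($G=SL_{n+1}(K)$), $N=2n+1$ in type $B_n$ ($G=SO_{2n+1}(K)$), $N=2n$ in types $C_n$ ($G=Sp_{2n}(K)$) and $D_n$ ($G=SO_{2n}(K)$). Here $n\ge 1$ in types $A_n,B_n,C_n$ and $n\ge 2$ in type $D_n$. The group $G$ in types $B_n,D_n$ (resp. $C_n$) consists of the determinant-one matrices in $GL_N(K)$ preserving the symmetric (resp. alternating) bilinear form with $\langle e_i,e_{N+1-i}\rangle=1$ for all $i$ (resp. $=1$ for $i\le n$ and $=-1$ for $i>n$), all other pairings of basis vectors being zero. The Borel subgroup is the group of upper triangular matrices in $G$, and $U$ is the group of upper triangular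 matrices in $G$ with $1$'s on the diagonal. Writing $E_{ij}$ for the elementary matrices, the simple root elements are, for $c\in K$: - type $A_n$: $\varepsilon_{\alpha_k}(c)=\mathrm{Id}+cE_{k,k+1}$ for $1\le k\le n$; - types $B_n,C_n,D_n$, $1\le k\le n-1$: $\varepsilon_{\alpha_k}(c)=\mathrm{Id}+c(E_{k,k+1}-E_{N-k,N+1-k})$; - type $B_n$: $\varepsilon_{\alpha_n}(c)=\mathrm{Id}+c(E_{n,n+1}-E_{n+1,n+2})-\frac{c^2}{2}E_{n,n+2}$; - type $C_n$: $\varepsilon_{\alpha_n}(c)=\mathrm{Id}+2cE_{n,n+1}$; - type $D_n$: $\varepsilon_{\alpha_n}(c)=\mathrm{Id}+c(E_{n-1,n+1}-E_{n,n+2})$. *)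

(* Defs.v *)
From HB Require Import structures.
From mathcomp Require Import all_boot all_order all_algebra.

Set Implicit Arguments.
Unset Strict Implicit.
Unset Printing Implicit Defensive.

Import GRing.Theory.
Local Open Scope ring_scope.

(* Groups are sets of square matrices, multiplied in the matrix ring.  H is   *)
(* meant to be a finite group and S a generating set; words use no formal     *)
(* inverses, and the empty word represents 1.                                 *)
Definition covered_by_words (A : pzSemiRingType) (H S : {pred A}) (l : nat) :
    Prop :=
  forall h : A, h \in H ->
    exists w : seq A,
      [/\ (size w <= l)%N, {subset w <= S} & h = \prod_(x <- w) x].

Definition is_diameter (A : pzSemiRingType) (H S : {pred A}) (d : nat) : Prop :=
  [/\ (0 < d)%N, covered_by_words H S d
    & forall l : nat, (0 < l)%N -> covered_by_words H S l -> (d <= l)%N].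

Inductive classical_type := TypeA | TypeB | TypeC | TypeD.

Definition min_rank (t : classical_type) : nat :=
  if t is TypeD then 2 else 1.

Definition dimN (t : classical_type) (n : nat) : nat :=
  match t with
  | TypeA => n.+1
  | TypeB => (2 * n).+1
  | TypeC | TypeD => 2 * n
  end.

Section ClassicalGroups.

Variables (K : finFieldType) (t : classical_type) (n : nat).

Local Notation N := (dimN t n).

(* Indices are 1-based, whereas ordinals are 0-based; E i j is 0 when i or j  *)
(* is not in [1, N].                                                          *)
Definition E (i j : nat) : 'M[K]_N :=
  \matrix_(a < N, b < N) ((a.+1 == i) && (b.+1 == j))%:R.

(* <e_i, e_j> for i = a + 1, j = b + 1, so i + j = N + 1; unused in type A.   *)
Definition form : 'M[K]_N :=
  \matrix_(a < N, b < N)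
    if (a.+1 + b.+1 == N.+1)%N then
      if t is TypeC then (if (a.+1 <= n)%N then 1 else -1) else 1
    else 0.

(* Matrices act on column vectors: <g x, g y> = x^T g^T form g y.             *)
Definition preserves_form (g : 'M[K]_N) : bool := g^T *m form *m g == form.

Definition chevalley : {set 'M[K]_N} :=
  match t with
  | TypeA => [set g : 'M[K]_N | \det g == 1]
  | _ => [set g : 'M[K]_N | (\det g == 1) && preserves_form g]
  end.

(* is_trig_mx means lower triangular. *)
Definition borel : {set 'M[K]_N} := [set g in chevalley | is_trig_mx g^T].

Definition unipotent : {set 'M[K]_N} :=
  [set g in borel | [forall i, g i i == 1]].

(* Meant for 1 <= k <= n. *)
Definition simple_root_elt (k : nat) (c : K) : 'M[K]_N :=
  match t with
  | TypeA => 1%:M + c *: E k k.+1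
  | _ =>
    if (k < n)%N then 1%:M + c *: (E k k.+1 - E (N - k) (N.+1 - k))
    else match t with
    | TypeB => 1%:M + c *: (E n n.+1 - E n.+1 n.+2)
                 - (c ^+ 2 / 2%:R) *: E n n.+2
    | TypeC => 1%:M + (2%:R * c) *: E n n.+1
    | _ => 1%:M + c *: (E n.-1 n.+1 - E n n.+2)
    end
  end.

Definition simple_generators : {set 'M[K]_N} :=
  [set simple_root_elt k.+1 1 | k : 'I_n]
    :|: [set simple_root_elt k.+1 (-1) | k : 'I_n].

End ClassicalGroups.

(* Main.v *)
Require Import Defs.
From HB Require Import structures.
From mathcomp Require Import all_boot all_order all_algebra.
From mathcomp Require Import zify ring lra.
From mathcomp Require Import boolp reals exp.

Set Implicit Arguments.
Unset Strict Implicit.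
Unset Printing Implicit Defensive.

Import Order.TTheory GRing.Theory Num.Theory.
Local Open Scope ring_scope.

(** Upper bound.  Left multiplication by a letter is a bounded number of elementary
row operations, so writing [g] as a short word amounts to bringing [g] to the
identity by few operations of this kind.  This is done one column at a time,
from the last to the first: [clean_column] makes one more column standard with
O(p + n log p) letters that respect the columns already treated.  The effect on
the other columns does not matter, because they are treated later; hence
O(n p + n^2 log p) letters in all ([unipotent_words]).

The cost of a column rests on chains: coordinates x_0, x_1, ..., x_m where x_0
is a nonzero constant s and the j-th operation adds plus or minus x_(j-1) to
x_j.  If x_0, ..., x_(j-1) all equal s, then d s can be added to x_j by writing
d = a + 2 (1 + d') with a = 0 or 1: add x_(j-1) to x_j a times, turn x_(j-1)
into s + d' s by the same method one step lower, add it to x_j twice.  The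
binary digits of d are thus spread over successive coordinates, at a bounded
cost for each, and undoing everything but the additions to x_j restores the
other coordinates ([shift_word]).  When the chain is exhausted after j steps, a
remainder of about p / 2^j is added letter by letter; these remainders sum to
O(p) over j.  So any values of x_1, ..., x_m are exchanged for any others with
O(p + m log p) operations ([chain_reach]).

In type A a column is one chain.  In types B, C, D a letter of index k < n acts
on the coordinates k and k + 1 of the upper half and on their mirror images in
the lower half.  The lower half is a chain hanging from the entry 1 of the
column ([lower_chain]).  Once it vanishes except for that entry, the letters
needed next leave it unchanged, and the upper half becomes a chain of its own, hanging from
a pivot in the middle ([upper_chain]).  Between the two, the letter of index n
sets the pivot to 1; a suitable nonzero value in the lower half is needed for
this, and it is put there and removed by further uses of the lower chain.
The top coordinate belongs to neither chain: isotropy of the column determines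
it in types B and D; in type C it is controlled by the pairing of the two
halves, which the letters of index k < n preserve.

Lower bound.  The superdiagonal entries are additive on U and each letter
changes one of them, so an element with at least n / 2 of them equal to
(p - 1) / 2 (up to a factor 2) needs at least n p / 6 letters
([abelian_lower_bound]).  For the other
term, U has at least p ^ (n^2 / 6) elements when n > 1 ([unipotent_card]),
whereas counting all words of length l would give (2 n) ^ l and lose a factor
log n.  But letters whose indices differ by 3 or more commute, so a word may be
sorted until its index never drops by more than 2 from one letter to the next;
such a word is encoded by n + 4 l bits ([count_words]). *)

(** * Chains of coordinates *)

Definition upd (F : Type) (x : nat -> F) (j : nat) (y : F) : nat -> F :=
  fun i => if i == j then y else x i.

Section Chain.
Variable F : comNzRingType.
Implicit Types (x : nat -> F) (w : seq (nat * bool)).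

(** A letter [(j, b)] stands for the [j]-th operation, with sign [(-1) ^+ b]. *)
Definition chain_step (a : nat * bool) x : nat -> F :=
  upd x a.1 (x a.1 + (-1) ^+ a.2 * x a.1.-1).

Definition chain_run w x : nat -> F := foldl (fun y a => chain_step a y) x w.

Definition flip (a : nat * bool) := (a.1, ~~ a.2).
Definition word_inv w := rev (map flip w).

Definition letters_in (lo hi : nat) w := all (fun a => lo <= a.1 <= hi)%N w.

Lemma size_word_inv w : size (word_inv w) = size w.
Proof. by rewrite size_rev size_map. Qed.

Lemma letters_in_inv lo hi w : letters_in lo hi (word_inv w) = letters_in lo hi w.
Proof. by rewrite /letters_in all_rev all_map; apply: eq_all. Qed.

Lemma letters_in_cat lo hi w1 w2 :
  letters_in lo hi (w1 ++ w2) = letters_in lo hi w1 && letters_in lo hi w2.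
Proof. exact: all_cat. Qed.

Lemma letters_inW lo hi hi' w : (hi <= hi')%N -> letters_in lo hi w -> letters_in lo hi' w.
Proof. by move=> h; apply: sub_all => a /andP[-> /leq_trans->]. Qed.

Lemma chain_run_cat w1 w2 x : chain_run (w1 ++ w2) x = chain_run w2 (chain_run w1 x).
Proof. exact: foldl_cat. Qed.

Lemma eq_chain_run w x y : x =1 y -> chain_run w x =1 chain_run w y.
Proof.
elim: w x y => [//|a w IH] x y e; apply: IH => i.
by rewrite /chain_step /upd !e.
Qed.

Lemma chain_run_out lo hi w x i : letters_in lo hi w -> ~~ (lo <= i <= hi)%N ->
  chain_run w x i = x i.
Proof.
elim: w x => [//|a w IH] x /= /andP[ha hw] hi'; rewrite IH //= /chain_step /upd.
by case: eqP => // e; rewrite e ha in hi'.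
Qed.

(** Operations of index below [j] never read coordinate [j], so changing that
coordinate before or after them is the same.  This is what lets a word be undone
on the lower coordinates while its contribution to coordinate [j] is kept. *)
Lemma chain_run_upd hi w x j y : letters_in 1 hi w -> (hi < j)%N ->
  chain_run w (upd x j y) =1 upd (chain_run w x) j y.
Proof.
move=> hw hj; elim: w x hw => [//|[k b] w IH] x /= /andP[ha hw] i.
rewrite -IH //; apply: eq_chain_run => {}i; rewrite /chain_step /upd /=.
have -> : (k == j) = false by lia.
have -> : (k.-1 == j) = false by lia.
by case: (eqVneq i k) => // ->; have -> : (k == j) = false by lia.
Qed.

Lemma chain_run_inv hi w x : letters_in 1 hi w -> chain_run (w ++ word_inv w) x =1 x.
Proof.
elim: w x => [//|a w IH] x /= /andP[ha hw] i.
rewrite /word_inv /= rev_cons -cats1 catA chain_run_cat.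
rewrite (eq_chain_run _ (IH _ hw)) /= /chain_step /upd /=.
have e : (a.1.-1 == a.1) = false by lia.
rewrite eqxx e; case: eqP => // ->; rewrite signrN; ring.
Qed.

Lemma chain_run_nseq d j b x : (0 < j)%N ->
  chain_run (nseq d (j, b)) x =1 upd x j (x j + (-1) ^+ b * x j.-1 *+ d).
Proof.
move=> hj; elim: d x => [|d IH] x i; first by rewrite /upd /= mulr0n addr0; case: eqP => // ->.
rewrite /= IH /chain_step /upd /= eqxx.
have -> : (j.-1 == j) = false by lia.
by case: eqP => // _; rewrite mulrS addrA.
Qed.

Lemma letters_in_nseq lo hi d j b : (lo <= j <= hi)%N -> letters_in lo hi (nseq d (j, b)).
Proof. by move=> h; rewrite /letters_in all_nseq /= h orbT. Qed.

(** The expansion d = a + 2 (1 + d') carried one coordinate down at each step; the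
lower coordinates are left in disorder.  The term [d %/ 2 ^ j.-1] is what
remains to be added one by one when coordinate 1 is reached. *)
Lemma horner_word s j d L : (0 < j)%N -> (d < 2 ^ L)%N ->
  exists w, [/\ (size w <= 3 * L + d %/ 2 ^ j.-1)%N, letters_in 1 j w
    & forall x, (forall i, (i < j)%N -> x i = s) -> chain_run w x j = x j + s *+ d].
Proof.
case: j => // j _; elim: j d L => [|j IH] d L hd.
  exists (nseq d (1%N, false)); split; rewrite ?letters_in_nseq //.
    by rewrite size_nseq divn1; lia.
  by move=> x hx; rewrite chain_run_nseq // /upd /= mul1r (hx 0%N).
have [d1|d2] := leqP d 1.
  exists (nseq d (j.+2, false)); split; rewrite ?letters_in_nseq ?leqnn //.
    rewrite size_nseq (leq_trans _ (leq_addr _ _)) //.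
    by case: L hd => [|L _]; [rewrite expn0 | ]; lia.
  by move=> x hx; rewrite chain_run_nseq // /upd /= eqxx mul1r (hx j.+1).
case: L hd => [|L] hd; first by rewrite expn0 in hd; lia.
(* d = odd d + 2 * (1 + (d./2 - 1)) *)
have [|w [sw lw rw]] := IH (d./2 - 1)%N L; first by rewrite expnS in hd; lia.
exists (nseq (odd d) (j.+2, false) ++ w ++ nseq 2 (j.+2, false)).
split.
- rewrite !size_cat !size_nseq /=.
  have : ((d./2 - 1) %/ 2 ^ j <= d %/ 2 ^ j.+1)%N.
    by rewrite expnS divnMA leq_div2r // divn2 leq_subr.
  by move: sw => /=; case: (odd d) => /=; lia.
- by rewrite !letters_in_cat !letters_in_nseq ?leqnn // (letters_inW _ lw).
move=> x hx; rewrite !chain_run_cat.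
rewrite chain_run_nseq // /upd eqxx /= mul1r.
rewrite (chain_run_out _ lw) ?ltnn ?andbF //.
rewrite rw; last first.
  move=> i hi; rewrite chain_run_nseq // /upd.
  have -> : (i == j.+2) = false by lia. apply: hx. lia.
rewrite !chain_run_nseq // /upd eqxx /= mul1r.
have -> : (j.+1 == j.+2) = false by lia.
rewrite (hx j.+1) // -addrA; congr (_ + _).
rewrite -mulrS -mulrnA -mulrnDr; congr (_ *+ _).
by have := odd_double_half d; lia.
Qed.

(** Undoing the part of [horner_word] that precedes the last additions to
coordinate [j] puts the lower coordinates back in order. *)
Lemma shift_word s j d L : (0 < j)%N -> (d < 2 ^ L)%N ->
  exists w, [/\ (size w <= 6 * L + (d %/ 2 ^ j.-1).*2)%N, letters_in 1 j w
    & forall x, (forall i, (i < j)%N -> x i = s) ->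
        chain_run w x =1 upd x j (x j + s *+ d)].
Proof.
case: j => // j _ hd.
have [d1|d2] := leqP d 1.
  exists (nseq d (j.+1, false)); split; rewrite ?letters_in_nseq ?leqnn //.
    rewrite size_nseq (leq_trans _ (leq_addr _ _)) //.
    by case: L hd => [|L _]; [rewrite expn0 | ]; lia.
  by move=> x hx i; rewrite chain_run_nseq // /upd /= mul1r (hx j).
case: j => [|j].
  exists (nseq d (1%N, false)); split; rewrite ?letters_in_nseq //.
    by rewrite size_nseq divn1; lia.
  by move=> x hx i; rewrite chain_run_nseq // /upd /= mul1r (hx 0%N).
case: L hd => [|L] hd; first by rewrite expn0 in hd; lia.
have [||w [sw lw rw]] := @horner_word s j.+1 (d./2 - 1) L => //.
  by rewrite expnS in hd; lia.
pose J := j.+2.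
exists (nseq (odd d) (J, false) ++ (w ++ nseq 2 (J, false)) ++ word_inv w).
split.
- rewrite !size_cat !size_nseq size_word_inv /=.
  have : ((d./2 - 1) %/ 2 ^ j <= d %/ 2 ^ j.+1)%N.
    by rewrite expnS divnMA leq_div2r // divn2 leq_subr.
  by move: sw => /=; case: (odd d) => /=; lia.
- rewrite !letters_in_cat !letters_in_nseq ?leqnn //.
  by rewrite letters_in_inv (letters_inW _ lw).
move=> x hx i; rewrite !chain_run_cat.
set x1 := chain_run (nseq (odd d) _) x.
have ex1 : x1 =1 upd x J (x J + s *+ odd d).
  by move=> l; rewrite /x1 chain_run_nseq // /= mul1r (hx j.+1).
have hx1 l : (l < J)%N -> x1 l = s.
  move=> hl; rewrite ex1 /upd.
  have -> : (l == J) = false by lia.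
  exact: hx.
have lwi : letters_in 1 j.+1 (word_inv w) by rewrite letters_in_inv.
set x2 := chain_run w x1.
rewrite (eq_chain_run _ (chain_run_nseq 2 false x2 (ltn0Sn _))).
rewrite (chain_run_upd _ _ lwi) //= mul1r /upd -chain_run_cat (chain_run_inv _ lw).
case: (i =P j.+2) => [_|ne]; last first.
  by rewrite ex1 /upd; case: (i =P J) ne.
rewrite /x2 (chain_run_out _ lw) ?ltnn ?andbF // rw; last by move=> l hl; apply: hx1; lia.
rewrite (hx1 j.+1) // ex1 /upd eqxx -addrA; congr (_ + _).
rewrite -mulrS -mulrnA -mulrnDr; congr (_ *+ _).
by have := odd_double_half d; lia.
Qed.

End Chain.

Lemma sum_div_pow2 d m : (\sum_(i < m) d %/ 2 ^ i <= d.*2)%N.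
Proof.
elim: m d => [|m IH] d; first by rewrite big_ord0.
rewrite big_ord_recl expn0 divn1.
under eq_bigr => i _ do rewrite lift0 expnS divnMA divn2.
have := IH d./2; have := odd_double_half d; move: (\sum_(i < m) _)%N; lia.
Qed.

Section ChainFp.
Variables (p L : nat).
Hypotheses (pr : prime p) (hL : (p < 2 ^ L)%N).
Local Notation F := 'F_p.

Lemma Fp_multiple (s a b : F) : s != 0 -> exists2 d, (d < p)%N & a + s *+ d = b.
Proof.
move=> s0; exists (nat_of_ord (s^-1 * (b - a))).
  have := ltn_ord (s^-1 * (b - a)); rewrite [X in (_ < X)%N -> _](@Fp_cast p) //.
by rewrite -mulr_natr natr_Zp mulrA mulfV // mul1r; ring.
Qed.

(** The coordinates are levelled upwards, since [shift_word] needs those below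
coordinate [j] to be equal already. *)
Lemma level_word (x : nat -> F) m : x 0%N != 0 ->
  exists w, [/\ (size w <= 6 * L * m + (\sum_(i < m) p %/ 2 ^ i).*2)%N,
    letters_in 1 m w
    & forall i, chain_run w x i = if (i <= m)%N then x 0%N else x i].
Proof.
move=> x0; elim: m => [|m [w [sw lw rw]]].
  by exists [::]; split => // -[|i].
have [d dp ed] := Fp_multiple (x m.+1) (x 0%N) x0.
have [||v [sv lv rv]] := @shift_word F (x 0%N) m.+1 d L => //; first exact: ltn_trans dp hL.
exists (w ++ v); split.
- rewrite size_cat big_ord_recr /=; move: sv => /=.
  have : (d %/ 2 ^ m <= p %/ 2 ^ m)%N by rewrite leq_div2r // ltnW.
  by move: (\sum_(i < m) _)%N sw => ?; lia.
- by rewrite letters_in_cat lv (letters_inW _ lw).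
move=> i; rewrite chain_run_cat rv => [|l hl]; last by rewrite rw -ltnS hl.
rewrite /upd !rw ltnn ed; case: (ltngtP i m.+1) => h //.
  by rewrite -ltnS h.
by have -> : (i <= m)%N = false by lia.
Qed.

(** The constant chain serves as a meeting point: level [x], then undo the
levelling of [y]. *)
Lemma chain_reach (x y : nat -> F) m : x 0%N != 0 ->
  exists w, [/\ (size w <= 12 * L * m + 8 * p)%N, letters_in 1 m w
    & forall i, (0 < i <= m)%N -> chain_run w x i = y i].
Proof.
move=> x0.
have [w1 [s1 l1 r1]] := level_word m x0.
pose z i := if (i == 0)%N then x 0%N else if (i <= m)%N then y i else x i.
have [|w2 [s2 l2 r2]] := @level_word z m; first by [].
exists (w1 ++ word_inv w2); split.
- rewrite size_cat size_word_inv; have := sum_div_pow2 p m.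
  by move: (\sum_(i < m) _)%N s1 s2 => ?; lia.
- by rewrite letters_in_cat l1 letters_in_inv.
move=> i hi; rewrite chain_run_cat.
have e : chain_run w1 x =1 chain_run w2 z.
  by move=> l; rewrite r1 r2 {1}/z /=; case: leqP => // hl; rewrite /z; case: l hl => // l hl;
    rewrite leqNgt hl.
rewrite (eq_chain_run _ e) -chain_run_cat (chain_run_inv _ l2) /z.
by case: i hi => // i /= ->.
Qed.

End ChainFp.

(** * Coordinates of column vectors *)

Section Coordinates.
Variables (K : fieldType) (N : nat).
Implicit Types v : 'cV[K]_N.

(** Coordinates indexed by natural numbers from 1, like the matrices [E i j], and
0 outside of [1, N]: index arithmetic such as N + 1 - k then needs no casts. *)
Definition vcoord v (i : nat) : K := \sum_(a < N) (a.+1 == i)%:R * v a 0.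

Lemma sum_indic (G : nat -> K) k :
  \sum_(a < N) (a.+1 == k)%:R * G a.+1 = (0 < k <= N)%N%:R * G k.
Proof.
case: (boolP (0 < k <= N)%N) => hk; last first.
  rewrite mul0r big1 // => a _.
  have -> : (a.+1 == k) = false by have := ltn_ord a; lia.
  by rewrite mul0r.
case: k hk => // k hk; rewrite (bigD1 (Ordinal hk)) //= eqxx big1 ?addr0 // => a ha.
by have -> : (a.+1 == k.+1) = false; [by apply: contraNF ha => /eqP[e];
  apply/eqP/val_inj | rewrite mul0r].
Qed.

Lemma sum_indic_const (C : K) k :
  \sum_(a < N) (a.+1 == k)%:R * C = (0 < k <= N)%N%:R * C.
Proof. exact: (sum_indic (fun=> C)). Qed.

Lemma vcoord_ord v (a : 'I_N) : vcoord v a.+1 = v a 0.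
Proof.
rewrite /vcoord (bigD1 a) //= eqxx mul1r big1 ?addr0 // => b ba.
by rewrite eqSS; have -> : (b == a :> nat) = false; [exact: negbTE | rewrite mul0r].
Qed.

Lemma vcoord_out v i : ~~ (0 < i <= N)%N -> vcoord v i = 0.
Proof.
move=> hi; rewrite /vcoord big1 // => a _.
have -> : (a.+1 == i) = false by have := ltn_ord a; lia.
by rewrite mul0r.
Qed.

Lemma vcoord_ext v v' : (forall i, (0 < i <= N)%N -> vcoord v i = vcoord v' i) -> v = v'.
Proof. by move=> h; apply/colP => a; rewrite -!vcoord_ord h //=. Qed.

Lemma vcoordD v v' i : vcoord (v + v') i = vcoord v i + vcoord v' i.
Proof. by rewrite -big_split; apply: eq_bigr => a _; rewrite mxE /= mulrDr. Qed.

Lemma vcoordZ c v i : vcoord (c *: v) i = c * vcoord v i.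
Proof. by rewrite /vcoord big_distrr; apply: eq_bigr => a _; rewrite mxE /=; ring. Qed.

Lemma vcoordN v i : vcoord (- v) i = - vcoord v i.
Proof. by rewrite -scaleN1r vcoordZ mulN1r. Qed.

Lemma vcoord_col (G : nat -> K) i : vcoord (\col_(a < N) G a.+1) i = (0 < i <= N)%N%:R * G i.
Proof. by rewrite -sum_indic; apply: eq_bigr => a _; rewrite mxE. Qed.

Lemma mx_act_inj (g h : 'M[K]_N) : (forall v, g *m v = h *m v) -> g = h.
Proof.
move=> e; apply/matrixP => a b.
by have := e (delta_mx b 0); rewrite -!colE => /colP/(_ a); rewrite !mxE.
Qed.

End Coordinates.

Lemma vcoord_E (K : finFieldType) t n i j (v : 'cV[K]_(dimN t n)) l :
  vcoord (E K t n i j *m v) l = ((0 < l <= dimN t n) && (l == i))%N%:R * vcoord v j.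
Proof.
have e a : (E K t n i j *m v) a 0 = (a.+1 == i)%:R * vcoord v j.
  rewrite mxE /vcoord big_distrr; apply: eq_bigr => b _.
  by rewrite mxE /= mulrA -natrM mulnb.
case: (boolP (0 < l <= dimN t n)%N) => hl; last by rewrite (vcoord_out _ hl) mul0r.
by case: l hl => // l hl; rewrite (vcoord_ord _ (Ordinal hl)) e.
Qed.

(** These two replace the index comparisons of the goal that follow from the
context by linear arithmetic. *)
Ltac decide_eqs := repeat match goal with
 | |- context [?a == ?b :> nat] =>
    first [ have -> : (a == b :> nat) = false by lia
          | have -> : (a == b :> nat) = true by lia ] end.
Ltac decide_ranges := repeat match goal with
 | |- context [leq ?a ?b] =>
    first [ have -> : leq a b = true by lia
          | have -> : leq a b = false by lia ] end.

(** * Action of the simple root elements *)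

Section RootElements.
Variable K : finFieldType.
Implicit Types (t : classical_type) (n k : nat) (c : K).

Definition has_form t := if t is TypeA then false else true.

Lemma vcoord_rootA n k c (v : 'cV_(dimN TypeA n)) i : (0 < k <= n)%N ->
  vcoord (simple_root_elt TypeA n k c *m v) i = vcoord v i + (i == k)%:R * (c * vcoord v k.+1).
Proof.
move=> hk; rewrite /simple_root_elt mulmxDl mul1mx -scalemxAl vcoordD vcoordZ vcoord_E.
case: (eqVneq i k) => [->|_]; last by rewrite andbF /=; ring.
by rewrite /dimN andbT; decide_ranges; ring.
Qed.

Lemma vcoord_rootL t n k c (v : 'cV_(dimN t n)) i : has_form t -> (0 < k < n)%N ->
  vcoord (simple_root_elt t n k c *m v) i = vcoord v i + (i == k)%:R * (c * vcoord v k.+1)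
    - (i == dimN t n - k)%N%:R * (c * vcoord v ((dimN t n).+1 - k)%N).
Proof.
move=> ht hk.
have hN : (2 * n <= dimN t n)%N by case: t ht {v} => //=.
have -> : simple_root_elt t n k c = 1%:M + c *: (E K t n k k.+1
    - E K t n (dimN t n - k) ((dimN t n).+1 - k)).
  by move: ht; rewrite /simple_root_elt; case: t {v hN} => //= _; have -> : (k < n)%N by lia.
rewrite mulmxDl mul1mx -scalemxAl mulmxBl vcoordD vcoordZ vcoordD vcoordN !vcoord_E.
case: (eqVneq i k) => [->|_]; case: eqP => [e|_]; rewrite ?andbF /= ?andbT; decide_ranges;
  rewrite /=; ring.
Qed.

Lemma vcoord_rootB n c (v : 'cV_(dimN TypeB n)) i : (0 < n)%N ->
  vcoord (simple_root_elt TypeB n n c *m v) i = vcoord v i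
   + (i == n)%:R * (c * vcoord v n.+1 - c ^+ 2 / 2%:R * vcoord v n.+2)
   - (i == n.+1)%:R * (c * vcoord v n.+2).
Proof.
move=> hk.
rewrite /simple_root_elt ltnn !(mulmxDl, mulNmx, mul1mx) -!scalemxAl mulmxBl.
rewrite !(vcoordD, vcoordN, vcoordZ, vcoord_E) /dimN.
case: (eqVneq i n) => [->|_]; case: eqP => [e|_]; rewrite ?andbF /= ?andbT; decide_ranges;
  rewrite /=; try lia; ring.
Qed.

Lemma vcoord_rootC n c (v : 'cV_(dimN TypeC n)) i : (0 < n)%N ->
  vcoord (simple_root_elt TypeC n n c *m v) i = vcoord v i
   + (i == n)%:R * (2%:R * c * vcoord v n.+1).
Proof.
move=> hk.
rewrite /simple_root_elt ltnn mulmxDl mul1mx -scalemxAl vcoordD vcoordZ vcoord_E /dimN.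
case: (eqVneq i n) => [->|_]; rewrite ?andbF /= ?andbT; decide_ranges; rewrite /=; ring.
Qed.

Lemma vcoord_rootD n c (v : 'cV_(dimN TypeD n)) i : (1 < n)%N ->
  vcoord (simple_root_elt TypeD n n c *m v) i = vcoord v i
   + (i == n.-1)%:R * (c * vcoord v n.+1) - (i == n)%:R * (c * vcoord v n.+2).
Proof.
move=> hk.
rewrite /simple_root_elt ltnn mulmxDl mul1mx -scalemxAl mulmxBl.
rewrite !(vcoordD, vcoordN, vcoordZ, vcoord_E) /dimN.
case: (eqVneq i n) => [->|_]; case: eqP => [e|_]; rewrite ?andbF /= ?andbT; decide_ranges;
  rewrite /=; try lia; ring.
Qed.

(** The formulas above cover all simple root elements: in types B, C, D only the
last one depends on the type. *)
Lemma root_cases (P : classical_type -> nat -> nat -> Prop) :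
  (forall n k, (0 < k <= n)%N -> P TypeA n k) ->
  (forall t n k, has_form t -> (0 < k < n)%N -> P t n k) ->
  (forall n, (0 < n)%N -> P TypeB n n) ->
  (forall n, (0 < n)%N -> P TypeC n n) ->
  (forall n, (1 < n)%N -> P TypeD n n) ->
  forall t n k, (min_rank t <= n)%N -> (0 < k <= n)%N -> P t n k.
Proof.
move=> hA hL hB hC hD t n k hn hk.
have [e|ne] := eqVneq k n; last first.
  by case: t hn => _; [apply: hA | apply: hL..] => //; lia.
by rewrite e in hk *; case: t hn => hn; [apply: hA|apply: hB|apply: hC|apply: hD] => //=.
Qed.

Lemma root_inv t n k c : (min_rank t <= n)%N -> (0 < k <= n)%N -> 2%:R != 0 :> K ->
  simple_root_elt t n k c *m simple_root_elt t n k (- c) = 1%:M.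
Proof.
move=> hn hk h2; apply: mx_act_inj => v; apply: vcoord_ext => i _.
rewrite mul1mx -mulmxA; move: v; move: t n k hn hk; apply: root_cases.
- move=> n k hk v; rewrite !vcoord_rootA //; decide_eqs; rewrite /=; ring.
- move=> t n k ht hk v.
  have hN : (2 * n <= dimN t n)%N by case: t ht {v} => //=.
  rewrite !vcoord_rootL //; decide_eqs; rewrite /=; ring.
- move=> n hn v; rewrite !vcoord_rootB //; decide_eqs; rewrite /=; field.
  exact: h2.
- move=> n hn v; rewrite !vcoord_rootC //; decide_eqs; rewrite /=; ring.
- move=> n hn v; rewrite !vcoord_rootD //; decide_eqs; rewrite /=; ring.
Qed.

(** If j + 2 < k, neither element reads a row that the other one modifies, in all
types.  In type D the elements of index n - 2 and n do not commute, whence the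
gap of 3. *)
Lemma root_commute t n j k c d : (min_rank t <= n)%N -> (0 < j)%N -> (j + 2 < k <= n)%N ->
  simple_root_elt t n j c *m simple_root_elt t n k d
  = simple_root_elt t n k d *m simple_root_elt t n j c.
Proof.
move=> hn hj hk; apply: mx_act_inj => v; apply: vcoord_ext => i _.
rewrite -!mulmxA; move: v hj hk.
have hk0 : (0 < k <= n)%N -> (j + 2 < k)%N -> (0 < j)%N -> forall v,
  vcoord (simple_root_elt t n j c *m (simple_root_elt t n k d *m v)) i =
  vcoord (simple_root_elt t n k d *m (simple_root_elt t n j c *m v)) i.
  move=> hk; move: t n k hn hk; apply: root_cases.
  - move=> n k hk hjk hj v; rewrite !vcoord_rootA //; try lia; decide_eqs; rewrite /=; ring.
  - move=> t n k ht hk hjk hj v.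
    have hN : (2 * n <= dimN t n)%N by case: t ht {v} => //=.
    rewrite !vcoord_rootL //; try lia; decide_eqs; rewrite /=; ring.
  - move=> n hn hjk hj v; rewrite !(vcoord_rootB, vcoord_rootL) //; try lia.
    rewrite /dimN; decide_eqs; rewrite /=; ring.
  - move=> n hn hjk hj v; rewrite !(vcoord_rootC, vcoord_rootL) //; try lia.
    rewrite /dimN; decide_eqs; rewrite /=; ring.
  - move=> n hn hjk hj v; rewrite !(vcoord_rootD, vcoord_rootL) //; try lia.
    rewrite /dimN; decide_eqs; rewrite /=; ring.
by move=> v hj hk; apply: hk0; lia.
Qed.

End RootElements.

(** * The invariant form *)

Section FormAndUnipotents.
Variable K : finFieldType.
Implicit Types (t : classical_type) (n k : nat) (c : K).

Definition pairing_sign t n (i : nat) : K :=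
  if t is TypeC then (if (i <= n)%N then 1 else -1) else 1.

Definition bform t n (x y : 'cV[K]_(dimN t n)) : K :=
  \sum_(a < dimN t n) pairing_sign t n a.+1 * vcoord x a.+1 * vcoord y (dimN t n - a)%N.

Lemma bformE t n (x y : 'cV[K]_(dimN t n)) :
  (x^T *m Defs.form K t n *m y) 0 0 = bform x y.
Proof.
rewrite mxE /bform; under eq_bigr do rewrite mxE big_distrl.
rewrite exchange_big; apply: eq_bigr => a _.
rewrite big_distrr; apply: eq_bigr => b _; rewrite !mxE /= vcoord_ord.
have -> : (a.+1 + b.+1 == (dimN t n).+1)%N = (b.+1 == dimN t n - a)%N.
  by have := ltn_ord a; have := ltn_ord b; lia.
rewrite -/(pairing_sign t n a.+1).
by case: eqP => _ /=; ring.
Qed.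

Lemma bform_delta t n (a b : 'I_(dimN t n)) :
  bform (delta_mx a 0) (delta_mx b 0) = Defs.form K t n a b.
Proof. by rewrite -bformE trmx_delta -rowE -colE !mxE. Qed.

Lemma preserves_formP t n (g : 'M[K]_(dimN t n)) :
  reflect (forall x y, bform (g *m x) (g *m y) = bform x y) (preserves_form g).
Proof.
apply: (iffP eqP) => [e x y|e].
  by rewrite -!bformE trmx_mul -[in RHS]e !mulmxA.
apply/matrixP => a b; rewrite -bform_delta -e -bformE trmx_mul.
transitivity (((delta_mx a 0 : 'cV_(dimN t n))^T *m (g^T *m Defs.form K t n *m g) *m (delta_mx
  b 0 : 'cV_(dimN t n))) 0 0).
  by rewrite trmx_delta -rowE -colE [RHS]mxE [RHS]mxE.
by rewrite !mulmxA.
Qed.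

Lemma root_preserves_form t n k c : has_form t -> (min_rank t <= n)%N ->
  (0 < k <= n)%N -> 2%:R != 0 :> K -> preserves_form (simple_root_elt t n k c).
Proof.
move=> ht hn hk h2; apply/preserves_formP; move: t n k hn hk ht; apply: root_cases.
- by [].
- move=> t n k ht hk _ x y.
  have hN : (2 * n <= dimN t n)%N by case: t ht {x y} => //=.
  pose N := dimN t n; pose f := pairing_sign t n.
  have fk : f k.+1 = f k by rewrite /f /pairing_sign; case: (t) => //; decide_ranges.
  have fk' : f (N - k)%N = f (N.+1 - k)%N.
    by rewrite /f /pairing_sign /N; case: (t) hN => //= hN; decide_ranges.
  pose xk := vcoord x k.+1; pose xk' := vcoord x (N.+1 - k)%N.
  pose yk := vcoord y k.+1; pose yk' := vcoord y (N.+1 - k)%N.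
  transitivity (\sum_(a < N) (f a.+1 * vcoord x a.+1 * vcoord y (N - a)%N
     + (a.+1 == k)%:R * (f k * c * xk * yk')
     - (a.+1 == N - k)%N%:R * (f (N - k)%N * c * xk' * yk)
     + (a.+1 == N.+1 - k)%N%:R * (f (N - k)%N * c * xk' * yk)
     - (a.+1 == k.+1)%N%:R * (f k * c * xk * yk'))).
    apply: eq_bigr => a _; rewrite !vcoord_rootL // -/N.
    have -> : (N - a = N.+1 - a.+1)%N by [].
    rewrite -/(f _) -/xk -/yk -/xk' -/yk'.
    have ha : (0 < a.+1 <= N)%N by have := ltn_ord a.
    move: (a.+1) ha => i ha.
    have -> : (N.+1 - i == k)%N = (i == N.+1 - k)%N by lia.
    have -> : (N.+1 - i == N - k)%N = (i == k.+1)%N by lia.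
    rewrite -/N in hN.
    have [->|n1] := eqVneq i k.
      by decide_eqs; rewrite -/yk' /=; ring.
    have [->|n2] := eqVneq i k.+1.
      by rewrite subSS fk -/xk; decide_eqs; rewrite /=; ring.
    have [->|n3] := eqVneq i (N - k)%N.
      have -> : (N.+1 - (N - k) = k.+1)%N by lia.
      by rewrite -/yk; decide_eqs; rewrite /=; ring.
    have [->|n4] := eqVneq i (N.+1 - k)%N.
      have -> : (N.+1 - (N.+1 - k) = k)%N by lia.
      by rewrite -fk' -/xk' /=; ring.
    by rewrite /=; ring.
  rewrite !(sumrB, big_split) /= -/N.
  rewrite !sum_indic_const -/N.
  rewrite -/N in hN; decide_ranges; rewrite /bform /f; ring.
- move=> n hn _ x y; rewrite /bform /pairing_sign /dimN.
  set N := (2 * n).+1.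
  pose x1 := vcoord x n.+1; pose x2 := vcoord x n.+2.
  pose y1 := vcoord y n.+1; pose y2 := vcoord y n.+2.
  pose d := c ^+ 2 / 2%:R.
  have hd : d + d = c ^+ 2 by rewrite /d; field; exact: h2.
  transitivity (\sum_(a < N) (1 * vcoord x a.+1 * vcoord y (N - a)%N
     + (a.+1 == n)%:R * ((c * x1 - d * x2) * y2)
     + (a.+1 == n.+1)%:R * (- c * x2 * y1 - c * y2 * x1 + c ^+ 2 * x2 * y2)
     + (a.+1 == n.+2)%:R * ((c * y1 - d * y2) * x2))).
    apply: eq_bigr => a _; rewrite !vcoord_rootB //.
    have -> : (N - a = N.+1 - a.+1)%N by [].
    rewrite -/x1 -/y1 -/x2 -/y2 -/d.
    have ha : (0 < a.+1 <= N)%N by have := ltn_ord a.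
    move: (a.+1) ha => i ha; rewrite /N in ha *.
    have -> : ((2 * n).+2 - i == n)%N = (i == n.+2)%N by lia.
    have -> : ((2 * n).+2 - i == n.+1)%N = (i == n.+1)%N by lia.
    have [->|n1] := eqVneq i n.
      have -> : ((2 * n).+2 - n = n.+2)%N by lia.
      by decide_eqs; rewrite -/y2 /=; ring.
    have [->|n2] := eqVneq i n.+1.
      have -> : ((2 * n).+2 - n.+1 = n.+1)%N by lia.
      by decide_eqs; rewrite -/x1 -/y1 /=; ring.
    have [->|n3] := eqVneq i n.+2.
      have -> : ((2 * n).+2 - n.+2 = n)%N by lia.
      by rewrite -/x2 /=; ring.
    by rewrite /=; ring.
  rewrite !(sumrB, big_split) /=.
  rewrite !sum_indic_const /N -hd; decide_ranges; rewrite ?(mulr1n, mul1r); ring.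
- move=> n hn _ x y; rewrite /bform /dimN.
  set N := (2 * n)%N; pose f := pairing_sign TypeC n.
  pose x1 := vcoord x n.+1; pose y1 := vcoord y n.+1.
  transitivity (\sum_(a < N) (f a.+1 * vcoord x a.+1 * vcoord y (N - a)%N
     + (a.+1 == n)%:R * (2%:R * c * x1 * y1)
     - (a.+1 == n.+1)%:R * (2%:R * c * x1 * y1))).
    apply: eq_bigr => a _; rewrite !vcoord_rootC //.
    have -> : (N - a = N.+1 - a.+1)%N by [].
    rewrite -/x1 -/y1 -/f.
    have ha : (0 < a.+1 <= N)%N by have := ltn_ord a.
    move: (a.+1) ha => i ha; rewrite /N in ha *.
    have -> : ((2 * n).+1 - i == n)%N = (i == n.+1)%N by lia.
    have [->|n1] := eqVneq i n.
      have -> : ((2 * n).+1 - n = n.+1)%N by lia.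
      by rewrite /f /pairing_sign leqnn; decide_eqs; rewrite -/y1 /=; ring.
    have [->|n2] := eqVneq i n.+1.
      have -> : ((2 * n).+1 - n.+1 = n)%N by lia.
      by rewrite /f /pairing_sign ltnn -/x1 /=; ring.
    by rewrite /=; ring.
  rewrite !(sumrB, big_split) /=.
  rewrite !sum_indic_const /N; decide_ranges; rewrite /f ?(mulr1n, mul1r); ring.
- move=> n hn _ x y; rewrite /bform /pairing_sign /dimN.
  set N := (2 * n)%N.
  pose x1 := vcoord x n.+1; pose x2 := vcoord x n.+2.
  pose y1 := vcoord y n.+1; pose y2 := vcoord y n.+2.
  transitivity (\sum_(a < N) (1 * vcoord x a.+1 * vcoord y (N - a)%N
     + (a.+1 == n.-1)%:R * (c * x1 * y2)
     - (a.+1 == n)%:R * (c * x2 * y1)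
     - (a.+1 == n.+1)%:R * (c * y2 * x1)
     + (a.+1 == n.+2)%:R * (c * y1 * x2))).
    apply: eq_bigr => a _; rewrite !vcoord_rootD //.
    have -> : (N - a = N.+1 - a.+1)%N by [].
    rewrite -/x1 -/y1 -/x2 -/y2.
    have ha : (0 < a.+1 <= N)%N by have := ltn_ord a.
    move: (a.+1) ha => i ha; rewrite /N in ha *.
    have -> : ((2 * n).+1 - i == n)%N = (i == n.+1)%N by lia.
    have -> : ((2 * n).+1 - i == n.-1)%N = (i == n.+2)%N by lia.
    have [->|n1] := eqVneq i n.
      have -> : ((2 * n).+1 - n = n.+1)%N by lia.
      by decide_eqs; rewrite -/y1 /=; ring.
    have [->|n2] := eqVneq i n.+1.
      have -> : ((2 * n).+1 - n.+1 = n)%N by lia.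
      by decide_eqs; rewrite -/x1 /=; ring.
    have [->|n3] := eqVneq i n.+2.
      have -> : ((2 * n).+1 - n.+2 = n.-1)%N by lia.
      by decide_eqs; rewrite -/x2 /=; ring.
    have [->|n4] := eqVneq i n.-1.
      have -> : ((2 * n).+1 - n.-1 = n.+2)%N by lia.
      by rewrite -/y2 /=; ring.
    by rewrite /=; ring.
  rewrite !(sumrB, big_split) /=.
  rewrite !sum_indic_const /N; decide_ranges; rewrite ?(mulr1n, mul1r); ring.
Qed.

End FormAndUnipotents.

(** * The unipotent group and words in its generators *)

Section UnipotentGroup.
Variable K : finFieldType.
Implicit Types (t : classical_type) (n k : nat) (c : K).

Lemma unipotentP t n (g : 'M[K]_(dimN t n)) :
  reflect [/\ forall a b : 'I_(dimN t n), (b < a)%N -> g a b = 0, forall a, g a a = 1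
            & has_form t -> preserves_form g]
    (g \in unipotent K t n).
Proof.
have dettri (h : 'M[K]_(dimN t n)) : (forall a b : 'I_(dimN t n), (b < a)%N -> h a b = 0) ->
    is_trig_mx h^T.
  by move=> hh; apply/is_trig_mxP => a b ab; rewrite mxE hh.
rewrite !inE; apply: (iffP idP).
  case/andP=> /andP[hc /is_trig_mxP ht] /forallP h1; split.
  - by move=> a b ab; have := ht _ _ ab; rewrite mxE.
  - by move=> a; apply/eqP.
  by move: hc; rewrite /chevalley; case: t {dettri ht h1} g => // g; rewrite inE => /andP[].
case=> ht h1 hf; rewrite (dettri _ ht) andbT; apply/andP; split; last first.
  by apply/forallP => a; rewrite h1.
have hdet : \det g == 1.
  by rewrite -det_tr det_trig ?dettri // big1 // => a _; rewrite mxE h1.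
by rewrite /chevalley; case: t g hf hdet {dettri ht h1} => g hf hdet; rewrite inE hdet // hf.
Qed.

Lemma unipotent1 t n : 1%:M \in unipotent K t n.
Proof.
apply/unipotentP; split.
- by move=> a b ab; rewrite mxE -val_eqE (gtn_eqF ab).
- by move=> a; rewrite mxE eqxx.
by move=> _; apply/preserves_formP => x y; rewrite !mul1mx.
Qed.

Lemma unipotentM t n (g h : 'M[K]_(dimN t n)) :
  g \in unipotent K t n -> h \in unipotent K t n -> g *m h \in unipotent K t n.
Proof.
move=> /unipotentP[gt g1 gf] /unipotentP[ht h1 hf]; apply/unipotentP; split.
- move=> a b ab; rewrite mxE big1 // => l _.
  have [la|al] := ltnP l a; first by rewrite gt ?mul0r.
  by rewrite ht ?mulr0 // (leq_trans ab).
- move=> a; rewrite mxE (bigD1 a) //= g1 h1 mulr1 big1 ?addr0 // => l la.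
  have [{}la|al|e] := ltngtP l a; first by rewrite gt ?mul0r.
  - by rewrite ht ?mulr0.
  by case/eqP: la; apply: val_inj.
by move=> hft; apply/preserves_formP => x y; rewrite -!mulmxA !(preserves_formP _ (gf hft))
  (preserves_formP _ (hf hft)).
Qed.

Definition basis_vec N m : 'cV[K]_N := \col_(a < N) (a.+1 == m)%:R.

Lemma vcoord_basis_vec N m i : vcoord (basis_vec N m) i = ((0 < i <= N) && (i == m))%N%:R.
Proof. by rewrite (vcoord_col _ (fun i => (i == m)%:R)) -natrM mulnb. Qed.

Lemma mul_basis_vec N (g : 'M[K]_N) (a b : 'I_N) : vcoord (g *m basis_vec N b.+1) a.+1 = g a b.
Proof.
rewrite vcoord_ord mxE (bigD1 b) //= mxE eqxx mulr1 big1 ?addr0 // => l lb.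
by rewrite mxE eqSS val_eqE (negbTE lb) mulr0.
Qed.

Lemma unipotent_basis_vec t n (g : 'M[K]_(dimN t n)) m : g \in unipotent K t n ->
  (0 < m <= dimN t n)%N ->
  (forall i, (m < i)%N -> vcoord (g *m basis_vec _ m) i = 0) /\ vcoord (g *m basis_vec _ m) m
    = 1.
Proof.
move=> /unipotentP[ht h1 _]; case: m => // m hm; split; last first.
  by have := mul_basis_vec g (Ordinal hm) (Ordinal hm); rewrite h1.
move=> i mi; have [/andP[i0 iN]|/vcoord_out//] := boolP (0 < i <= dimN t n)%N.
case: i mi i0 iN => // i mi _ iN.
by have := mul_basis_vec g (Ordinal iN) (Ordinal hm); rewrite /= => ->; apply: ht.
Qed.

Lemma root_unipotent t n k c : (min_rank t <= n)%N -> (0 < k <= n)%N -> 2%:R != 0 :> K ->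
  simple_root_elt t n k c \in unipotent K t n.
Proof.
move=> hn hk h2.
have key : forall (a b : 'I_(dimN t n)), (b <= a)%N ->
  simple_root_elt t n k c a b = (a == b)%:R.
  move=> a b ab; rewrite -mul_basis_vec.
  have -> : (a == b) = (a.+1 == b.+1) by [].
  move: (a.+1) (ltn_ord a : 0 < a.+1 <= _)%N (b.+1) (ltn_ord b : 0 < b.+1 <= _)%N (ab : b.+1
    <= a.+1)%N.
  move=> {a b ab}; move: t n k hn hk; apply: root_cases.
  - move=> n k hk i hi m hm mi; rewrite vcoord_rootA // !vcoord_basis_vec hi.
    case: (eqVneq i k) => [e|_] /=; last by ring.
    have -> : (k.+1 == m) = false by lia.
    by rewrite andbF /=; ring.
  - move=> t n k ht hk i hi m hm mi.
    have hN : (2 * n <= dimN t n)%N by case: t ht {hi hm} => //=.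
    rewrite vcoord_rootL // !vcoord_basis_vec hi.
    case: (eqVneq i k) => [e|_] /=; case: (i =P (dimN t n - k)%N) => [e'|_] /=; decide_eqs;
      rewrite ?andbF /=; try ring; lia.
  - move=> n hn i hi m hm mi; rewrite vcoord_rootB // !vcoord_basis_vec hi.
    case: (eqVneq i n) => [e|_] /=; case: (i =P n.+1) => [e'|_] /=; decide_eqs;
      rewrite ?andbF /=; try ring; lia.
  - move=> n hn i hi m hm mi; rewrite vcoord_rootC // !vcoord_basis_vec hi.
    case: (eqVneq i n) => [e|_] /=; decide_eqs; rewrite ?andbF /=; try ring; lia.
  - move=> n hn i hi m hm mi; rewrite vcoord_rootD // !vcoord_basis_vec hi.
    case: (eqVneq i n.-1) => [e|_] /=; case: (i =P n) => [e'|_] /=; decide_eqs;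
      rewrite ?andbF /=; try ring; lia.
apply/unipotentP; split.
- move=> a b ab; rewrite key ?(ltnW ab) //.
  by case: eqP => // e; rewrite e ltnn in ab.
- by move=> a; rewrite key ?eqxx.
by move=> ht; apply: root_preserves_form.
Qed.

Definition letter t n (a : nat * bool) : 'M[K]_(dimN t n) :=
  simple_root_elt t n a.1 ((-1) ^+ a.2).

Definition wprod t n (w : seq (nat * bool)) : 'M[K]_(dimN t n) :=
  foldr (fun a g => letter t n a *m g) 1%:M w.

Lemma wprod_cat t n w1 w2 : wprod t n (w1 ++ w2) = wprod t n w1 *m wprod t n w2.
Proof. by elim: w1 => [|a w IH] /=; rewrite ?mul1mx // IH mulmxA. Qed.

Lemma wprodE t n w : wprod t n w = \prod_(x <- map (letter t n) w) x.
Proof. by elim: w => [|a w IH]; rewrite ?big_nil //= big_cons IH. Qed.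

Lemma letters_inWl lo lo' hi w : (lo' <= lo)%N -> letters_in lo hi w -> letters_in lo' hi w.
Proof. by move=> h; apply: sub_all => a /andP[/(leq_trans h)->]. Qed.

Section Words.
Variables (t : classical_type) (n : nat).
Hypotheses (hn : (min_rank t <= n)%N) (h2 : 2%:R != 0 :> K).

Lemma letter_flip a : (0 < a.1 <= n)%N -> letter t n a *m letter t n (flip a) = 1%:M.
Proof. by move=> ha; rewrite /letter /flip /= signrN root_inv. Qed.

Lemma wprod_inv w : letters_in 1 n w -> wprod t n w *m wprod t n (word_inv w) = 1%:M.
Proof.
elim: w => [_|a w IH /= /andP[ha hw]]; first by rewrite mul1mx.
rewrite /word_inv /= rev_cons -cats1 -/(word_inv w) wprod_cat -mulmxA.
by rewrite (mulmxA (wprod t n w)) IH // mul1mx /= mulmx1 letter_flip.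
Qed.

Lemma wprod_inv' w : letters_in 1 n w -> wprod t n (word_inv w) *m wprod t n w = 1%:M.
Proof. by move=> /wprod_inv/mulmx1C. Qed.

Lemma wprod_unipotent w : letters_in 1 n w -> wprod t n w \in unipotent K t n.
Proof.
elim: w => [_|a w IH /= /andP[ha hw]]; first exact: unipotent1.
by rewrite unipotentM ?IH // root_unipotent.
Qed.

End Words.

Section Standard.
Variables (t : classical_type) (n : nat).

(** The induction hypothesis of the sweep: the last [j] columns are those of the
identity. *)
Definition standard_tail j (g : 'M[K]_(dimN t n)) :=
  forall m, (dimN t n - j < m <= dimN t n)%N -> g *m basis_vec _ m = basis_vec _ m.

Lemma standard_tail0 g : standard_tail 0 g.
Proof. by move=> m; lia. Qed.

Lemma standard_tailM j g h : standard_tail j g -> standard_tail j h ->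
  standard_tail j (g *m h).
Proof. by move=> hg hh m hm; rewrite -mulmxA hh ?hg. Qed.

Lemma wprod_standard_tail j lo hi w : (forall k c, (lo <= k <= hi)%N ->
  standard_tail j (simple_root_elt t n k c)) ->
  letters_in lo hi w -> standard_tail j (wprod t n w).
Proof.
move=> h; elim: w => [_ m|a w IH /= /andP[ha hw]]; first by rewrite mul1mx.
by apply: standard_tailM; [apply: h | apply: IH].
Qed.

(** Pairing [g *m x] with the fixed vector of index N + 1 - i reads off its
coordinate [i]: the form turns standard last columns into standard first rows. *)
Lemma standard_tail_row g j x i : has_form t -> g \in unipotent K t n -> standard_tail j g ->
  (j <= dimN t n)%N -> (0 < i <= j)%N -> vcoord (g *m x) i = vcoord x i.
Proof.
move=> ht /unipotentP[_ _ /(_ ht)/preserves_formP hf] hs hj hi.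
set N := dimN t n.
have bf (y : 'cV_(dimN t n)) : bform y (basis_vec N (N.+1 - i)%N) = pairing_sign K t n i *
  vcoord y i.
  transitivity (\sum_(a < N) (a.+1 == i)%:R * (pairing_sign K t n a.+1 * vcoord y a.+1)).
    apply: eq_bigr => a _; rewrite vcoord_basis_vec mulrC; congr (_%:R * _).
    by have := ltn_ord a; rewrite -/N; lia.
  rewrite (sum_indic _ (fun i => pairing_sign K t n i * vcoord y i)).
  by have -> : (0 < i <= N)%N; [lia | rewrite mul1r].
have := hf x (basis_vec N (N.+1 - i)%N); rewrite hs; last by rewrite -/N; lia.
rewrite !bf => /mulfI; apply.
by rewrite /pairing_sign; case: (t) => //; try case: ifP; rewrite ?oppr_eq0 oner_eq0.
Qed.

End Standard.
End UnipotentGroup.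

(** * Moving column vectors by words *)

Section Moves.
Variables (p L : nat).
Hypotheses (pr : prime p) (hL : (p < 2 ^ L)%N).
Local Notation F := 'F_p.
Variables (t : classical_type) (n : nat).
Local Notation N := (dimN t n).
Implicit Types v : 'cV[F]_N.

Definition reach lo hi l v v' := exists w,
  [/\ letters_in lo hi w, (size w <= l)%N & v' = wprod F t n w *m v].

Lemma reach_refl lo hi l v : reach lo hi l v v.
Proof. by exists [::]; split; rewrite //= mul1mx. Qed.

Lemma reach_trans lo hi l1 l2 v1 v2 v3 :
  reach lo hi l1 v1 v2 -> reach lo hi l2 v2 v3 -> reach lo hi (l1 + l2) v1 v3.
Proof.
move=> [w1 [i1 s1 ->]] [w2 [i2 s2 ->]]; exists (w2 ++ w1); split.
- by rewrite letters_in_cat i1 i2.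
- by rewrite size_cat addnC leq_add.
by rewrite wprod_cat mulmxA.
Qed.

Lemma reachW lo hi l l' v v' : (l <= l')%N -> reach lo hi l v v' -> reach lo hi l' v v'.
Proof. by move=> h [w [i s e]]; exists w; split=> //; apply: leq_trans h. Qed.

Definition chain_cost m := (12 * L * m + 8 * p)%N.

(** Transfers [chain_reach] to column vectors.  The functions [X] read a chain off a
vector as long as [Inv] holds; the rest of the vector is only known through
[Inv].  [s] tells whether the letters act with the opposite sign. *)
Lemma chain_move lo hi m (X : nat -> 'cV[F]_N -> F) (letter_of : nat -> nat) (s : bool)
    (Inv : 'cV[F]_N -> Prop) v (y : nat -> F) :
  (forall j, (0 < j <= m)%N -> (lo <= letter_of j <= hi)%N) ->
  (forall j (b : bool) u, (0 < j <= m)%N -> Inv u ->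
     let u' := simple_root_elt t n (letter_of j) ((-1) ^+ b) *m u in
     Inv u' /\ forall i, (i <= m)%N ->
       X i u' = X i u + (i == j)%:R * ((-1) ^+ (b (+) s) * X j.-1 u)) ->
  Inv v -> X 0%N v != 0 ->
  exists v', [/\ reach lo hi (chain_cost m) v v', Inv v'
    & forall i, (i <= m)%N -> X i v' = if i == 0%N then X 0%N v else y i].
Proof.
move=> hk hs hv hX.
(* Beyond [m] the functions [X] need not behave like a chain, so the chain is
   cut off there. *)
pose tx u i := if (i <= m)%N then X i u else 0.
have sim w : letters_in 1 m w -> forall u, Inv u -> exists u',
    [/\ reach lo hi (size w) u u', Inv u' & tx u' =1 chain_run w (tx u)].
  elim: w => [_ u hu|[j b] w IH /= /andP[ha hw] u hu].
    by exists u; split=> //; apply: reach_refl.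
  have [hu1 hX1] := hs j (b (+) s) u ha hu.
  have [u2 [r2 h2' e2]] := IH hw _ hu1.
  exists u2; split=> //.
    rewrite -add1n; apply: reach_trans r2.
    exists [:: (letter_of j, b (+) s)]; split=> //=; first by rewrite hk.
    by rewrite mulmx1.
  move=> i; rewrite e2; apply: eq_chain_run => {}i.
  rewrite /tx /chain_step /upd /=.
  case: (leqP i m) => him; last by have -> : (i == j) = false by lia.
  rewrite hX1 // -addbA addbb addbF.
  case: eqP => [->|_]; last by rewrite mul0r addr0.
  have -> : (j <= m)%N by lia.
  have -> : (j.-1 <= m)%N by lia.
  by rewrite mul1r.
have hX' : tx v 0%N != 0 by [].
have [w [sw lw rw]] := @chain_reach p L pr hL (tx v) y m hX'.
have [v' [r' h' e']] := sim w lw v hv.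
exists v'; split=> //; first exact: reachW r'.
move=> i him; have := e' i; rewrite /tx him => ->.
case: eqP => [->|i0]; last by apply: rw; lia.
by rewrite (chain_run_out _ lw).
Qed.

End Moves.

Section ColumnA.
Variables (p L : nat).
Hypotheses (pr : prime p) (hL : (p < 2 ^ L)%N).
Variable n : nat.
Local Notation N := (dimN TypeA n).

(** In type A the column N - j is a chain starting from its lowest nonzero entry,
which is 1. *)
Lemma columnA j (v : 'cV['F_p]_N) : (j <= n)%N ->
  (forall i, (N - j < i)%N -> vcoord v i = 0) -> vcoord v (N - j)%N = 1 ->
  reach 1 (n - j) (chain_cost p L n) v (basis_vec _ N (N - j)%N).
Proof.
move=> hj v0 v1; rewrite /dimN in v0 v1 *.
have [||||v' [r i e]] := @chain_move p L pr hL TypeA n 1 (n - j) (n - j)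
  (fun i u => vcoord u (n.+1 - j - i)%N) (fun i => n.+1 - j - i)%N false
  (fun u => forall i, (n.+1 - j < i)%N -> vcoord u i = 0) v (fun=> 0).
- by move=> i hi; lia.
- move=> i b u hi hu; split.
    move=> l hl; rewrite vcoord_rootA; last by lia.
    by rewrite (hu l hl); decide_eqs; rewrite /=; ring.
  move=> l hl; rewrite vcoord_rootA; last by lia.
  rewrite addbF; congr (_ + _%:R * (_ * vcoord u _)); lia.
- by [].
- by rewrite subn0 v1 oner_neq0.
apply: (reachW (l := chain_cost p L (n - j))).
  by rewrite /chain_cost leq_add2r leq_mul2l leq_subr orbT.
rewrite (_ : basis_vec _ _ _ = v') //.
apply: vcoord_ext => l /andP[l0 lN]; rewrite vcoord_basis_vec l0 lN /=.
have [hl|hl] := ltnP (n.+1 - j) l.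
  by rewrite i //; decide_eqs.
have := e (n.+1 - j - l)%N; rewrite subKn // => -> ; last by lia.
by rewrite subn0 v1; have -> : (l == n.+1 - j)%N = (n.+1 - j - l == 0)%N by [lia|]; case: eqP.
Qed.

End ColumnA.

Lemma dimN_bounds t n : has_form t -> (2 * n <= dimN t n <= (2 * n).+1)%N.
Proof. by case: t => // _ /=; lia. Qed.

(** * Columns in types B, C and D *)

Section PairedCoordinates.
Variable K : finFieldType.
Implicit Types (t : classical_type) (n j k : nat).

(** The shape of column N - j of an element whose last [j] columns are standard: its
first [j] entries vanish as well, by [standard_tail_row]. *)
Definition column_like t n j (v : 'cV[K]_(dimN t n)) :=
  (forall i, (i <= j)%N || (dimN t n - j < i)%N -> vcoord v i = 0)
  /\ vcoord v (dimN t n - j)%N = 1.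

(** In type D the letter n changes row n - 1, hence the bound on [j]; in the other
types it only says that j < n. *)
Lemma column_like_root t n j k c (v : 'cV[K]_(dimN t n)) :
  has_form t -> (j + min_rank t <= n)%N -> (j < k <= n)%N ->
  column_like j v -> column_like j (simple_root_elt t n k c *m v).
Proof.
move=> ht hj hk; have hk' : (0 < k <= n)%N by lia.
have hn : (min_rank t <= n)%N by lia.
move: v hk ht hj; rewrite /column_like; move: t n k hn hk'; apply: root_cases.
- by [].
- move=> t n k ht hk v hjk _ hj [v0 v1].
  have := dimN_bounds n ht => hN.
  by split=> [i hi|]; rewrite vcoord_rootL ?v1 ?(v0 _ hi) //; decide_eqs; rewrite /=; ring.
- move=> m hm v hjk _ hj [v0 v1]; rewrite /dimN in v0 v1 *.
  split=> [i hi|]; rewrite vcoord_rootB // ?v1 ?(v0 _ hi) //; decide_eqs; rewrite /=; ring.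
- move=> m hm v hjk _ hj [v0 v1]; rewrite /dimN in v0 v1 *.
  split=> [i hi|]; rewrite vcoord_rootC // ?v1 ?(v0 _ hi) //; decide_eqs; rewrite /=; ring.
- move=> m hm v hjk _ /= hj [v0 v1]; rewrite /dimN in v0 v1 *.
  split=> [i hi|]; rewrite vcoord_rootD // ?v1 ?(v0 _ hi) //; decide_eqs; rewrite /=; ring.
Qed.

(** The natural pairing of the two halves, on which the letters k < n act as a
matrix and its inverse transpose. *)
Definition half_pairing t n (v : 'cV[K]_(dimN t n)) : K :=
  \sum_(a < n) vcoord v a.+1 * vcoord v (dimN t n - a)%N.

Lemma half_pairing_levi t n k c (v : 'cV[K]_(dimN t n)) : has_form t -> (0 < k < n)%N ->
  half_pairing (simple_root_elt t n k c *m v) = half_pairing v.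
Proof.
move=> ht hk; rewrite /half_pairing; have := dimN_bounds n ht => hN.
set N := dimN t n in hN *.
pose x1 := vcoord v k.+1; pose x2 := vcoord v (N.+1 - k)%N.
transitivity (\sum_(a < n) (vcoord v a.+1 * vcoord v (N - a)%N
     + (a.+1 == k)%:R * (c * x1 * x2) - (a.+1 == k.+1)%:R * (c * x1 * x2))).
  apply: eq_bigr => a _; rewrite !vcoord_rootL // -/N.
  have -> : (N - a = N.+1 - a.+1)%N by [].
  rewrite -/x1 -/x2.
  have ha : (0 < a.+1 <= n)%N by have := ltn_ord a.
  move: (a.+1) ha => i ha.
  have -> : (N.+1 - i == N - k)%N = (i == k.+1)%N by lia.
  have [->|n1] := eqVneq i k.
    by decide_eqs; rewrite -/x2 /=; ring.
  have [->|n2] := eqVneq i k.+1.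
    by rewrite subSS; decide_eqs; rewrite -/x1 /=; ring.
  by decide_eqs; rewrite /=; ring.
rewrite !(sumrB, big_split) /= !sum_indic_const; decide_ranges; rewrite /=; ring.
Qed.

Lemma half_pairing_C n c (v : 'cV[K]_(dimN TypeC n)) : (0 < n)%N ->
  half_pairing (simple_root_elt TypeC n n c *m v)
  = half_pairing v + 2%:R * c * vcoord v n.+1 ^+ 2.
Proof.
move=> hn; rewrite /half_pairing /dimN; set N := (2 * n)%N.
pose x1 := vcoord v n.+1.
transitivity (\sum_(a < n) (vcoord v a.+1 * vcoord v (N - a)%N
     + (a.+1 == n)%:R * (2%:R * c * x1 * x1))).
  apply: eq_bigr => a _; rewrite !vcoord_rootC //.
  have -> : (N - a = N.+1 - a.+1)%N by [].
  rewrite -/x1.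
  have ha : (0 < a.+1 <= n)%N by have := ltn_ord a.
  move: (a.+1) ha => i ha; rewrite /N.
  have [->|n1] := eqVneq i n.
    have -> : ((2 * n).+1 - n = n.+1)%N by lia.
    by decide_eqs; rewrite -/x1 /=; ring.
  by decide_eqs; rewrite /=; ring.
rewrite !(sumrB, big_split) /= !sum_indic_const; decide_ranges; rewrite /=.
by rewrite /x1; ring.
Qed.

(** The coordinate from which the chain of the upper half hangs. *)
Definition pivot t n := if t is TypeB then n.+1 else n.

(** The common target of all columns: entries 1 at the pivot and at N - j, and a top
entry [z] which the two chains do not reach. *)
Definition reduced_at t n j (z : K) (i : nat) : K :=
  if i == (dimN t n - j)%N then 1 else if i == pivot t n then 1
  else if i == j.+1 then z else 0.

Lemma bform_reduced t n j z (v : 'cV[K]_(dimN t n)) : has_form t -> t <> TypeC ->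
  (j.+1 < pivot t n)%N -> (forall i, (0 < i <= dimN t n)%N ->
    vcoord v i = reduced_at t n j z i) ->
  bform v v = 2%:R * z + (if t is TypeB then 1 else 0).
Proof.
move=> ht hC hj hv; have := dimN_bounds n ht => hN.
pose e : K := if t is TypeB then 1 else 0.
transitivity (\sum_(a < dimN t n) ((a.+1 == j.+1)%:R * z + (a.+1 == dimN t n - j)%N%:R * z
   + (a.+1 == pivot t n)%:R * e)).
  apply: eq_bigr => a _; have ha := ltn_ord a.
  have -> : pairing_sign K t n a.+1 = 1 by case: t hC {hN ht hj v hv e ha} a.
  rewrite !hv; try lia.
  have -> : (dimN t n - a = (dimN t n).+1 - a.+1)%N by [].
  have {}ha : (0 < a.+1 <= dimN t n)%N by [].
  move: (a.+1) ha => i ha; rewrite mul1r /reduced_at.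
  have -> : ((dimN t n).+1 - i == dimN t n - j)%N = (i == j.+1)%N by lia.
  have -> : ((dimN t n).+1 - i == j.+1)%N = (i == dimN t n - j)%N by lia.
  move: hN hj ha; rewrite /e /pivot; case: (t) ht hC => //= _ _ hN hj ha.
    have [->|n1] := eqVneq i j.+1; first by decide_eqs; rewrite /=; ring.
    have [->|n2] := eqVneq i ((2 * n).+1 - j)%N; first by decide_eqs; rewrite /=; ring.
    have [->|n3] := eqVneq i n.+1; first by decide_eqs; rewrite /=; ring.
    by decide_eqs; rewrite /=; ring.
  have [->|n1] := eqVneq i j.+1; first by decide_eqs; rewrite /=; ring.
  have [->|n2] := eqVneq i (2 * n - j)%N; first by decide_eqs; rewrite /=; ring.
  have [->|n3] := eqVneq i n; first by decide_eqs; rewrite /=; ring.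
  by rewrite /=; ring.
rewrite !big_split /= !sum_indic_const.
have -> : (0 < pivot t n <= dimN t n)%N by case: (t) ht hj hN => //= _; lia.
have -> : (0 < j.+1 <= dimN t n)%N by case: (t) ht hj hN => //= _; lia.
have -> : (0 < dimN t n - j <= dimN t n)%N by case: (t) ht hj hN => //= _; lia.
by rewrite /= -/e; ring.
Qed.

End PairedCoordinates.

Section PairedColumns.
Variables (p L : nat).
Hypotheses (pr : prime p) (hL : (p < 2 ^ L)%N).
Local Notation F := 'F_p.
Local Notation cost n := (chain_cost p L n).

(** Entry N - j, equal to 1, is the source.  The letters used are j + 1, ..., n - 1;
in the upper half they only move the coordinates below index n, and nothing is
claimed about these beyond the pairing. *)
Lemma lower_chain t n j (v : 'cV[F]_(dimN t n)) (y : nat -> F) :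
  has_form t -> (j + min_rank t <= n)%N -> column_like j v ->
  exists v', [/\ reach j.+1 n (cost n) v v', column_like j v',
    half_pairing v' = half_pairing v,
    forall i, (n <= i <= dimN t n - n)%N -> vcoord v' i = vcoord v i
    & forall i, (dimN t n - n < i < dimN t n - j)%N -> vcoord v' i = y i].
Proof.
move=> ht hj hv; have hN := dimN_bounds n ht.
have jn : (j < n)%N by case: (t) hj => /=; lia.
set N := dimN t n in hN *.
have [||||v' [r [c q m] e]] := @chain_move p L pr hL t n j.+1 n (n - j.+1)
  (fun i u => vcoord u (N - j - i)%N) (fun i => j + i)%N true
  (fun u => [/\ column_like j u, half_pairing u = half_pairing v
     & forall i, (n <= i <= N - n)%N -> vcoord u i = vcoord v i]) v (fun i => y (N - j - i)%N).
- by move=> i hi; lia.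
- move=> i b u hi [hu1 hu2 hu3]; split.
    split.
    + by apply: column_like_root => //; lia.
    + by rewrite half_pairing_levi //; lia.
    move=> l hl; rewrite vcoord_rootL //; last lia.
    rewrite hu3 // -/N.
    by decide_eqs; rewrite /=; ring.
  move=> l hl; rewrite vcoord_rootL //; last lia.
  rewrite -/N.
  have -> : (N - j - l == j + i)%N = false by lia.
  have -> : (N - j - l == N - (j + i))%N = (l == i)%N by lia.
  have -> : (N.+1 - (j + i) = N - j - i.-1)%N by lia.
  by rewrite addbT signrN /=; ring.
- by split.
- by case: hv => _; rewrite subn0 => ->; rewrite oner_neq0.
exists v'; split=> //.
  by apply: reachW r; rewrite /chain_cost leq_add2r leq_mul2l leq_subr orbT.
move=> i hi; have := e (N - j - i)%N; rewrite subKn; last lia.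
by move=> ->; [case: eqP => //; lia | lia].
Qed.

(** The mirror image of the operation reads a coordinate of the lower half that is
assumed to vanish. *)
Lemma upper_root t n j k c (u : 'cV[F]_(dimN t n)) l :
  has_form t -> (j.+1 < k < pivot t n)%N ->
  (forall i, (pivot t n < i < dimN t n - j)%N -> vcoord u i = 0) ->
  vcoord (simple_root_elt t n k c *m u) l = vcoord u l + (l == k)%:R * (c * vcoord u k.+1).
Proof.
move=> ht hk u0; have hN := dimN_bounds n ht.
have hp : (n <= pivot t n <= n.+1)%N by rewrite /pivot; case: (t); lia.
have [kn|nk] := ltnP k n.
  rewrite vcoord_rootL //; last lia.
  rewrite (u0 (_ - k)%N) ?mulr0 ?subr0 //; lia.
have e : k = n by lia.
rewrite e in hk *; case: t ht u u0 hk hp {hN nk} => //= _ u u0 hk _; try lia.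
by rewrite vcoord_rootB ?(u0 n.+2) ?mulr0 ?subr0 //; lia.
Qed.

(** The letters start at j + 2, so that the source at N - j is not read and the top
coordinate j + 1 does not move. *)
Lemma upper_chain t n j (v : 'cV[F]_(dimN t n)) :
  has_form t -> (j + min_rank t <= n)%N -> (j.+1 < pivot t n)%N -> column_like j v ->
  (forall i, (pivot t n < i < dimN t n - j)%N -> vcoord v i = 0) ->
  vcoord v (pivot t n) = 1 ->
  exists v', reach j.+1 n (cost n) v v' /\
    forall i, (0 < i <= dimN t n)%N -> vcoord v' i = reduced_at t n j (vcoord v j.+1) i.
Proof.
move=> ht hj hp hv v0 v1; have hN := dimN_bounds n ht.
have jn : (j < n)%N by case: (t) hj => /=; lia.
have hr : (n <= pivot t n <= n.+1)%N by rewrite /pivot; case: (t); lia.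
set N := dimN t n in hN v0 *; set r := pivot t n in hp v0 v1 hr *.
have [||||v' [rv [c z q] e]] := @chain_move p L pr hL t n j.+1 n (r - j.+2)
  (fun i u => vcoord u (r - i)%N) (fun i => r - i)%N false
  (fun u => [/\ column_like j u, forall i, (r < i < N - j)%N -> vcoord u i = 0
     & vcoord u j.+1 = vcoord v j.+1]) v (fun i => 0).
- by move=> i hi; lia.
- move=> i b u hi [hu1 hu2 hu3].
  have key l := @upper_root t n j (r - i)%N ((-1) ^+ b) u l ht ltac:(rewrite -/r; lia) hu2.
  split; first split.
  + by apply: column_like_root => //; lia.
  + by move=> l hl; rewrite key hu2 //; decide_eqs; rewrite /=; ring.
  + by rewrite key hu3; decide_eqs; rewrite /=; ring.
  move=> l hl; rewrite key addbF; congr (_ + _%:R * (_ * vcoord u _)); lia.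
- by [].
- by rewrite subn0 v1 oner_neq0.
exists v'; split.
  by apply: reachW rv; rewrite /chain_cost leq_add2r leq_mul2l; apply/orP; right; lia.
move=> i hi; rewrite /reduced_at -/N -/r.
have [->|n1] := eqVneq i (N - j)%N; first by case: c.
have [->|n2] := eqVneq i r; first by have := e 0%N isT; rewrite subn0 v1.
have [->|n3] := eqVneq i j.+1; first exact: q.
have [h|h] := boolP ((i <= j) || (N - j < i))%N; first by case: c => c0 _; apply: c0.
have [ri|ir] := ltnP r i; first by apply: z; lia.
have := e (r - i)%N; rewrite subKn // => -> ; last lia.
by case: eqP => // ?; lia.
Qed.

End PairedColumns.

Arguments simple_root_elt : simpl never.
Section ReducedColumns.
Variables (p L : nat).
Hypotheses (pr : prime p) (hL : (p < 2 ^ L)%N) (h2 : 2%:R != 0 :> 'F_p).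
Local Notation F := 'F_p.
Local Notation cost n := (chain_cost p L n).

Lemma reach_bform t n j l (v v' : 'cV[F]_(dimN t n)) : has_form t -> (min_rank t <= n)%N ->
  reach j.+1 n l v v' -> bform v' v' = bform v v.
Proof.
move=> ht hn [w [lw _ ->]]; have /unipotentP[_ _ /(_ ht)/preserves_formP] := 
  wprod_unipotent hn h2 (letters_inWl (isT : 1 <= j.+1)%N lw).
exact.
Qed.

Definition reduced_column t n j z : 'cV[F]_(dimN t n) := \col_a reduced_at t n j z a.+1.

Lemma vcoord_reduced t n j z i : (0 < i <= dimN t n)%N ->
  vcoord (reduced_column t n j z) i = reduced_at t n j z i.
Proof. by move=> hi; rewrite vcoord_col hi mul1r. Qed.

Lemma reduce_upper t n j (v : 'cV[F]_(dimN t n)) :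
  has_form t -> (j + min_rank t <= n)%N -> (j.+1 < pivot t n)%N -> column_like j v ->
  (forall i, (pivot t n < i < dimN t n - j)%N -> vcoord v i = 0) ->
  vcoord v (pivot t n) = 1 ->
  reach j.+1 n (cost n) v (reduced_column t n j (vcoord v j.+1)).
Proof.
move=> ht hj hp hv v0 v1; have [v' [r e]] := upper_chain pr hL ht hj hp hv v0 v1.
rewrite (_ : reduced_column _ _ _ _ = v') //; apply: vcoord_ext => i hi.
by rewrite e // vcoord_reduced.
Qed.

(** Isotropy is preserved by words and, by [bform_reduced], determines the top entry
of a reduced column. *)
Lemma reduce_upper_isotropic t n j (v : 'cV[F]_(dimN t n)) :
  has_form t -> t <> TypeC ->
  (j + min_rank t <= n)%N -> (j.+1 < pivot t n)%N -> column_like j v -> bform v v = 0 ->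
  (forall i, (pivot t n < i < dimN t n - j)%N -> vcoord v i = 0) ->
  vcoord v (pivot t n) = 1 ->
  reach j.+1 n (cost n) v (reduced_column t n j (if t is TypeB then - 2%:R^-1 else 0)).
Proof.
move=> ht hC hj hp hv vv v0 v1; have r := reduce_upper ht hj hp hv v0 v1.
have hn : (min_rank t <= n)%N by lia.
have := reach_bform ht hn r; rewrite vv (bform_reduced ht hC hp (@vcoord_reduced t n j _)).
move=> e; pose z : F := if t is TypeB then - 2%:R^-1 else 0.
suff ez : z = vcoord v j.+1 by rewrite -/z ez.
apply: (mulfI h2); apply/eqP; rewrite -subr_eq0 -oppr_eq0 -[X in _ == X]e -subr_eq0; apply/eqP.
by rewrite /z; case: (t) (vcoord v j.+1) => y; field.
Qed.

(** The letter n adds a multiple of coordinate n + 2 to the pivot n + 1.  So coordinate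
n + 2, the end of the lower chain, is set to 1, the pivot is set to 1, and the
lower half is then cleared without touching the pivot. *)
Lemma columnB n j (v : 'cV[F]_(dimN TypeB n)) : (j < n)%N -> column_like j v ->
  bform v v = 0 ->
  reach j.+1 n (6 * cost n) v (reduced_column TypeB n j (- 2%:R^-1)).
Proof.
move=> jn hv vv.
have hj : (j + min_rank TypeB <= n)%N by rewrite /=; lia.
have [v1 [r1 c1 _ _ l1]] := lower_chain pr hL (fun i =>
  (i == n.+2)%:R) (isT : has_form TypeB) hj hv.
rewrite /dimN in c1 l1.
have v1n : vcoord v1 n.+2 = 1.
  have [e|ne] := eqVneq j.+1 n.
    by case: c1 => _ <-; congr vcoord; rewrite /dimN; lia.
  by rewrite l1 ?eqxx //; lia.
have [||||v2 [r2 [c2 l2] e2]] := @chain_move p L pr hL TypeB n j.+1 n 1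
  (fun i u => vcoord u (n.+2 - i)%N) (fun i => n) true
  (fun u => column_like j u /\ forall i, (n.+1 < i)%N -> vcoord u i = vcoord v1 i) v1 (fun=>
    1).
- by move=> *; lia.
- move=> i b u hi [u1 u2]; split; first split.
  + by apply: column_like_root => //; lia.
  + by move=> l hl; rewrite vcoord_rootB; [rewrite u2 //; decide_eqs; rewrite /=; ring | lia].
  move=> l hl; have -> : i = 1%N by lia.
  case: l hl => [|[|//]] _; rewrite vcoord_rootB ?(subn0, subn1) /=; try lia; decide_eqs;
    rewrite addbT signrN /=; ring.
- by [].
- by rewrite subn0 v1n oner_neq0.
have /= := e2 1%N isT; rewrite subn1 /= => v2n.
have [v3 [r3 c3 _ m3 l3]] := lower_chain pr hL (fun=> 0) (isT : has_form TypeB) hj c2.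
rewrite /dimN in m3 l3.
have r4 : reach j.+1 n (cost n) v3 (reduced_column TypeB n j (- 2%:R^-1)).
  apply: (@reduce_upper_isotropic TypeB n j) => //=.
  - rewrite (reach_bform _ _ r3) // ?(reach_bform _ _ r2) ?(reach_bform _ _ r1) //=; lia.
  - by move=> i hi; apply: l3; lia.
  - by rewrite m3 //; lia.
apply: reachW (reach_trans r1 (reach_trans r2 (reach_trans r3 r4))).
by rewrite /chain_cost; nia.
Qed.

(** The letter n adds a multiple of coordinate n + 2 to the pivot n, and one of
coordinate n + 1 to coordinate n - 1.  So coordinate n + 2 is set to 1, the pivot
is set to 1, and the lower half is then cleared. *)
Lemma columnD n j (v : 'cV[F]_(dimN TypeD n)) : (j.+1 < n)%N -> column_like j v ->
  bform v v = 0 ->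
  reach j.+1 n (6 * cost n) v (reduced_column TypeD n j 0).
Proof.
move=> jn hv vv.
have hj : (j + min_rank TypeD <= n)%N by rewrite /=; lia.
have [v1 [r1 c1 _ _ l1]] := lower_chain pr hL (fun i =>
  (i == n.+2)%:R) (isT : has_form TypeD) hj hv.
rewrite /dimN in c1 l1.
have v1n : vcoord v1 n.+2 = 1.
  have [e|ne] := eqVneq j.+2 n.
    by case: c1 => _ <-; congr vcoord; rewrite /dimN; lia.
  by rewrite l1 ?eqxx //; lia.
have [||||v2 [r2 [c2 l2] e2]] := @chain_move p L pr hL TypeD n j.+1 n 1
  (fun i u => if i == 0%N then vcoord u n.+2 else vcoord u n) (fun i => n) true
  (fun u => column_like j u /\ forall i, (n < i)%N -> vcoord u i = vcoord v1 i) v1 (fun=> 1).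
- by move=> *; lia.
- move=> i b u hi [u1 u2]; split; first split.
  + by apply: column_like_root => //; lia.
  + by move=> l hl; rewrite vcoord_rootD; [rewrite u2 //; decide_eqs; rewrite /=; ring | lia].
  move=> l hl; have -> : i = 1%N by lia.
  case: l hl => [|[|//]] _ /=; rewrite vcoord_rootD; try lia; decide_eqs;
    rewrite addbT signrN /=; ring.
- by [].
- by rewrite v1n oner_neq0.
have /= v2n := e2 1%N isT.
have [v3 [r3 c3 _ m3 l3]] := lower_chain pr hL (fun=> 0) (isT : has_form TypeD) hj c2.
rewrite /dimN in m3 l3.
have r4 : reach j.+1 n (cost n) v3 (reduced_column TypeD n j 0).
  apply: (@reduce_upper_isotropic TypeD n j) => //=.
  - rewrite (reach_bform _ _ r3) // ?(reach_bform _ _ r2) ?(reach_bform _ _ r1) //=; lia.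
  - by move=> i hi; apply: l3; lia.
  - by rewrite m3 //; lia.
apply: reachW (reach_trans r1 (reach_trans r2 (reach_trans r3 r4))).
by rewrite /chain_cost; nia.
Qed.

(** The letter n of type C, the only one that changes the pairing of the halves. *)
Lemma turnC n j (v : 'cV[F]_(dimN TypeC n)) (b : F) : (j < n)%N -> column_like j v ->
  vcoord v n.+1 != 0 ->
  exists v', [/\ reach j.+1 n (cost n) v v', column_like j v', vcoord v' n = b,
     forall i, (n < i)%N -> vcoord v' i = vcoord v i
   & half_pairing v' = half_pairing v + (b - vcoord v n) * vcoord v n.+1].
Proof.
move=> jn hv vn.
have [||||v2 [r2 [c2 l2 q2] e2]] := @chain_move p L pr hL TypeC n j.+1 n 1
  (fun i u => if i == 0%N then 2%:R * vcoord u n.+1 else vcoord u n) (fun i => n) false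
  (fun u => [/\ column_like j u, forall i, (n < i)%N -> vcoord u i = vcoord v i
     & half_pairing u - vcoord u n * vcoord u n.+1 = half_pairing v - vcoord v n * vcoord v
       n.+1]) v (fun=> b).
- by move=> *; lia.
- move=> i s u hi [u1 u2 u3]; split; first split.
  + by apply: column_like_root => //=; lia.
  + by move=> l hl; rewrite vcoord_rootC; [rewrite u2 //; decide_eqs; rewrite /=; ring | lia].
  + rewrite half_pairing_C ?vcoord_rootC; try lia.
    by decide_eqs; rewrite -u3 /=; ring.
  move=> l hl; have -> : i = 1%N by lia.
  case: l hl => [|[|//]] _ /=; rewrite !vcoord_rootC; try lia; decide_eqs;
    rewrite addbF /=; ring.
- by [].
- by rewrite mulf_neq0.
have /= v2n := e2 1%N isT.
exists v2; split=> //.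
  by apply: reachW r2; rewrite /chain_cost; nia.
by move: q2; rewrite v2n (l2 n.+1) // => /(canRL (subrK _)) ->; ring.
Qed.

(** Once the lower half is cleared, the top coordinate equals the pairing of the two
halves.  Changing the pivot by e while coordinate n + 1 has value u changes the
pairing by e u; so two passes, with u = 1 up to the value [b] of the pivot and
with u = 2 from there to 1, give any desired pairing by the choice of [b]. *)
Lemma columnC n j (v : 'cV[F]_(dimN TypeC n)) : (j.+1 < n)%N -> column_like j v ->
  reach j.+1 n (6 * cost n) v (reduced_column TypeC n j 0).
Proof.
move=> jn hv.
have hj : (j + min_rank TypeC <= n)%N by rewrite /=; lia.
have jn' : (j < n)%N by lia.
have [v1 [r1 c1 q1 m1 l1]] := lower_chain pr hL (fun i =>
  (i == n.+1)%:R) (isT : has_form TypeC) hj hv.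
have v1n : vcoord v1 n.+1 = 1 by rewrite l1 ?eqxx //= ; lia.
(* solves half_pairing v1 + (b - vcoord v1 n) * 1 + (1 - b) * 2 = 0 *)
pose b := half_pairing v1 - vcoord v1 n + 2%:R.
have [|v2 [r2 c2 e2 l2 q2]] := turnC b jn' c1; first by rewrite v1n oner_neq0.
have [v3 [r3 c3 q3 m3 l3]] := lower_chain pr hL (fun i =>
  (i == n.+1)%:R *+ 2) (isT : has_form TypeC) hj c2.
have v3n : vcoord v3 n.+1 = 2%:R by rewrite l3 ?eqxx //=; lia.
have [|v4 [r4 c4 e4 l4 q4]] := turnC 1 jn' c3; first by rewrite v3n.
have [v5 [r5 c5 q5 m5 l5]] := lower_chain pr hL (fun=> 0) (isT : has_form TypeC) hj c4.
have v5n : vcoord v5 n = 1 by rewrite m5 ?e4 //=; lia.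
have v5z : forall i, (n < i < dimN TypeC n - j)%N -> vcoord v5 i = 0.
  by move=> i hi; apply: l5; rewrite /= in hi *; lia.
have q50 : half_pairing v5 = 0.
  rewrite q5 q4 q3 q2 v3n v1n m3 ?e2 /b; first by ring.
  by rewrite /=; lia.
have v5j : vcoord v5 j.+1 = 0.
  rewrite -q50 /half_pairing (bigD1 (Ordinal jn')) //= big1 ?addr0.
    by case: c5 => _ ->; rewrite mulr1.
  move=> a ha; have [aj|ja] := leqP a j.
    case: c5 => c5 _; rewrite (c5 a.+1) ?mul0r //.
    have : (a != j :> nat) by rewrite -val_eqE in ha.
    by lia.
  by rewrite (v5z (2 * n - a)%N) ?mulr0 //=; have := ltn_ord a; lia.
have r6 : reach j.+1 n (cost n) v5 (reduced_column TypeC n j 0).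
  by rewrite -v5j; apply: reduce_upper.
apply: reachW (reach_trans r1 (reach_trans r2 (reach_trans r3 (reach_trans r4 (reach_trans r5
  r6))))).
by rewrite /chain_cost; nia.
Qed.

(** With rank 1 left, coordinates n and n + 1 form a chain by themselves. *)
Lemma columnC_last n (v : 'cV[F]_(dimN TypeC n)) : (0 < n)%N -> column_like n.-1 v ->
  reach n.-1.+1 n (6 * cost n) v (basis_vec _ _ n.+1).
Proof.
move=> n0 hv; have hj : (n.-1 < n)%N by lia.
have vn : vcoord v n.+1 = 1 by case: hv => _ <-; congr vcoord; rewrite /=; lia.
have [|v' [r [c0 c1] e _ _]] := turnC 0 hj hv; first by rewrite vn oner_neq0.
rewrite (_ : basis_vec _ _ _ = v'); first by apply: reachW r; rewrite /chain_cost; nia.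
apply: vcoord_ext => i hi; rewrite vcoord_basis_vec hi /=; rewrite /dimN in c0 c1 hi.
have [->|n1] := eqVneq i n.+1; first by rewrite -c1; congr vcoord; lia.
have [->|n2] := eqVneq i n; first by rewrite e.
by rewrite c0 //; lia.
Qed.

End ReducedColumns.

(** * Sweeping the columns *)

Section Sweep.
Variables (p L : nat).
Hypotheses (pr : prime p) (hL : (p < 2 ^ L)%N) (h2 : 2%:R != 0 :> 'F_p).
Local Notation F := 'F_p.
Local Notation cost n := (chain_cost p L n).
Implicit Types (t : classical_type) (n j : nat).

(** The letters of stage [j] lie between these bounds, which make them fix the last
[j] basis vectors ([root_standard_tail]). *)
Definition stage_lo t j := if t is TypeA then 1%N else j.+1.
Definition stage_hi t n j := if t is TypeA then (n - j)%N else n.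

Lemma stage_range t n j w : letters_in (stage_lo t j) (stage_hi t n j) w -> letters_in 1 n w.
Proof.
apply: sub_all => a /andP[a1 a2]; apply/andP; split.
  by apply: leq_trans a1; case: t a2.
by apply: leq_trans a2 _; case: t a1 => //= _; apply: leq_subr.
Qed.

Lemma bform_basis_vec t n j : has_form t -> t <> TypeC -> (j < n)%N ->
  bform (basis_vec F (dimN t n) (dimN t n - j)%N) (basis_vec F (dimN t n) (dimN t n - j)%N) =
    0.
Proof.
move=> ht hC jn; rewrite /bform big1 // => a _; rewrite !vcoord_basis_vec.
have hN := dimN_bounds n ht.
have ha := ltn_ord a.
case: eqP => [e|_]; last by rewrite andbF mulr0 mul0r.
by have -> : (dimN t n - a == dimN t n - j)%N = false; [lia | rewrite andbF mulr0].
Qed.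

Lemma column_like_basis_vec t n j (g : 'M[F]_(dimN t n)) : has_form t ->
  (j + min_rank t <= n)%N ->
  g \in unipotent F t n -> standard_tail j g ->
    column_like j (g *m basis_vec F _ (dimN t n - j)%N).
Proof.
move=> ht hj hg hs; have hN := dimN_bounds n ht.
have jn : (j < n)%N by case: (t) hj => //=; lia.
have [|g0 g1] := unipotent_basis_vec (m := dimN t n - j) hg; first lia.
split=> // i /orP[ij|]; last exact: g0.
have [i0|i0] := posnP i; first by rewrite vcoord_out // i0.
rewrite (standard_tail_row _ ht hg hs) ?vcoord_basis_vec; try lia.
have -> : (i == dimN t n - j)%N = false by lia.
by rewrite andbF.
Qed.

Lemma column_normal_form t n j : (j + min_rank t <= n)%N ->
  exists s, forall g, g \in unipotent F t n -> standard_tail j g ->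
    reach (stage_lo t j) (stage_hi t n j) (6 * cost n) (g *m basis_vec F _ (dimN t n - j)%N) s.
Proof.
move=> hj.
have cl g ht hg hs := @column_like_basis_vec t n j g ht hj hg hs.
have iso g : has_form t -> t <> TypeC -> g \in unipotent F t n ->
    bform (g *m basis_vec F _ (dimN t n - j)%N) (g *m basis_vec F _ (dimN t n - j)%N) = 0.
  move=> ht hC /unipotentP[_ _ /(_ ht)/preserves_formP->].
  by apply: bform_basis_vec => //; case: (t) hj => /=; lia.
case: t hj cl iso => hj cl iso; rewrite /min_rank in hj.
- exists (basis_vec F _ (n.+1 - j)%N) => g hg hs.
  have [|g0 g1] := @unipotent_basis_vec F TypeA n g (n.+1 - j) hg; first by rewrite /=; lia.
  have hj' : (j <= n)%N by lia.
  by apply: reachW (columnA pr hL hj' g0 g1); rewrite /chain_cost; nia.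
- exists (@reduced_column p TypeB n j (- 2%:R^-1)) => g hg hs.
  by apply: (columnB pr hL h2); [lia | exact: cl | exact: iso].
- have [jn|jn] := ltnP j.+1 n.
    exists (@reduced_column p TypeC n j 0) => g hg hs.
    by apply: (columnC pr hL h2); [ | exact: cl].
  exists (basis_vec F _ n.+1) => g hg hs; have e : j = n.-1 by lia.
  rewrite e in hs cl *; have hc := cl g isT hg hs.
  have eN : (dimN TypeC n - n.-1 = n.+1)%N by rewrite /=; lia.
  by rewrite eN in hc *; apply: (columnC_last pr hL h2) hc; lia.
exists (@reduced_column p TypeD n j 0) => g hg hs.
by apply: (columnD pr hL h2); [lia | exact: cl | exact: iso].
Qed.

Lemma root_standard_tail t n j k c : (j + min_rank t <= n)%N ->
  (stage_lo t j <= k <= stage_hi t n j)%N -> standard_tail j (simple_root_elt t n k (c : F)).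
Proof.
move=> hj hk m hm; apply: vcoord_ext => i hi.
have hn : (min_rank t <= n)%N by lia.
have hk' : (0 < k <= n)%N by case: (t) hk => /=; lia.
rewrite /stage_lo /stage_hi in hk.
move: i hi m hm hk hj; move: t n k hn hk'; apply: root_cases.
- move=> n k hk i hi m hm hjk /= hj; rewrite vcoord_rootA // /dimN in hm hi *;
  rewrite !vcoord_basis_vec /=.
  by decide_eqs; rewrite ?andbF /=; ring.
- move=> t n k ht hk i hi m hm hjk hj; have hN := dimN_bounds n ht.
  rewrite vcoord_rootL // !vcoord_basis_vec; have {}hjk : (j < k)%N by case: (t) ht hjk =>
    //= _; lia.
  by decide_eqs; rewrite ?andbF /=; ring.
- move=> n hn i hi m hm hjk hj; rewrite /dimN in hi hm *;
  rewrite vcoord_rootB // !vcoord_basis_vec.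
  by decide_eqs; rewrite ?andbF /=; ring.
- move=> n hn i hi m hm hjk hj; rewrite /dimN in hi hm *;
  rewrite vcoord_rootC // !vcoord_basis_vec.
  by decide_eqs; rewrite ?andbF /=; ring.
- move=> n hn i hi m hm hjk /= hj; rewrite /dimN in hi hm *;
  rewrite vcoord_rootD // !vcoord_basis_vec.
  by decide_eqs; rewrite ?andbF /=; ring.
Qed.

(** The column of [g] and the basis vector both reach the normal form; going from
the former to the latter cleans the column. *)
Lemma clean_column t n j (g : 'M[F]_(dimN t n)) : (j + min_rank t <= n)%N ->
  g \in unipotent F t n -> standard_tail j g ->
  exists w, [/\ letters_in 1 n w, (size w <= 12 * cost n)%N &
    standard_tail j.+1 (wprod F t n w *m g)].
Proof.
move=> hj hg hs; have hn : (min_rank t <= n)%N by lia.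
have [s hs'] := column_normal_form hj.
have [w1 [l1 s1 e1]] := hs' g hg hs.
have [|w0 [l0 s0 e0]] := hs' 1%:M (unipotent1 _ _ _).
  by move=> m hm; rewrite mul1mx.
rewrite mul1mx in e0.
exists (word_inv w0 ++ w1); split.
- by rewrite letters_in_cat letters_in_inv !(@stage_range t n j).
- by rewrite size_cat size_word_inv; lia.
have hw : standard_tail j (wprod F t n (word_inv w0 ++ w1)).
  apply: (@wprod_standard_tail _ _ _ _ (stage_lo t j) (stage_hi t n j)).
    by move=> k c; apply: root_standard_tail.
  by rewrite letters_in_cat letters_in_inv l0.
move=> m hm; have [e|ne] := eqVneq m (dimN t n - j)%N; last first.
  by apply: (standard_tailM hw hs); lia.
rewrite e -mulmxA wprod_cat -(mulmxA (wprod _ _ _ _)) -e1 e0 mulmxA wprod_inv' ?mul1mx //.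
exact: stage_range l0.
Qed.

(** In type D the sweep stops at rank 1, where the only entry left undecided is killed
by isotropy, the characteristic being odd. *)
Lemma standard_tail_eq1 t n (g : 'M[F]_(dimN t n)) : (min_rank t <= n)%N ->
  g \in unipotent F t n -> standard_tail (n.+1 - min_rank t) g -> g = 1%:M.
Proof.
move=> hn hg hs.
have gev m i : (0 < m <= dimN t n)%N -> (m <= i)%N ->
  vcoord (g *m basis_vec F _ m) i = vcoord (basis_vec F (dimN t n) m) i.
  move=> hm mi; have [g0 g1] := unipotent_basis_vec hg hm; rewrite vcoord_basis_vec.
  have [->|ne] := eqVneq i m; first by rewrite g1 hm.
  by rewrite g0 ?andbF //; lia.
suff key m : (0 < m <= dimN t n)%N -> g *m basis_vec F _ m = basis_vec F (dimN t n) m.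
  apply/matrixP => a b; rewrite -mul_basis_vec key ?ltn_ord // vcoord_basis_vec ltn_ord /=.
  by rewrite mxE.
move=> hm; apply: vcoord_ext => i hi.
have [mi|im] := leqP m i; first exact: gev.
have [hms|hms] := ltnP (dimN t n - (n.+1 - min_rank t)) m; first by rewrite hs // hms; lia.
have [ht|ht] := boolP (has_form t); last first.
  by exfalso; move: ht hms im hi hn; case: (t) => //= _; lia.
have hN := dimN_bounds n ht.
have row l : (0 < l <= n.+1 - min_rank t)%N ->
    vcoord (g *m basis_vec F _ m) l = vcoord (basis_vec F (dimN t n) m) l.
  by apply: standard_tail_row => //; move: hN; case: (t) => /=; lia.
have [h|h] := boolP (i <= n.+1 - min_rank t)%N; first by apply: row; lia.
have tD : t = TypeD.
  by move: hms im hi h hn ht {hN}; case: (t) => //= *; exfalso; lia.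
subst t; have [ei em] : i = n /\ m = n.+1 by rewrite /= in hms h hi; lia.
subst i m; set v := g *m basis_vec F _ n.+1 in row *.
have vv : bform v v = 0.
  have /unipotentP[_ _ /(_ isT)/preserves_formP ->] := hg.
  have jn : (n.-1 < n)%N by rewrite /= in hn; lia.
  have := @bform_basis_vec TypeD n n.-1 isT; rewrite (_ : _ - n.-1 = n.+1)%N;
    last by rewrite /=; lia.
  exact.
have vE l : (0 < l <= dimN TypeD n)%N ->
  vcoord v l = (l == n.+1)%:R + (l == n)%:R * vcoord v n.
  move=> hl; have [->|ne] := eqVneq l n; first by decide_eqs; rewrite /=; ring.
  have ce : vcoord (basis_vec F (dimN TypeD n) n.+1) l = (l == n.+1)%:R by rewrite
    vcoord_basis_vec hl.
  rewrite mul0r addr0 -ce; have [nl|ln] := ltnP n l; first exact: gev.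
  by apply: row; rewrite /= in hl *; lia.
have e2 : bform v v = 2%:R * vcoord v n.
  transitivity (\sum_(a < dimN TypeD n) ((a.+1 == n)%:R * vcoord v n + (a.+1 == n.+1)%:R *
    vcoord v n)).
    apply: eq_bigr => a _; have ha := ltn_ord a; rewrite /= in ha.
    rewrite /pairing_sign (vE a.+1) // (vE (dimN _ _ - a)%N) ?leq_subr ?subn_gt0 ?ltn_ord //.
    have -> : (dimN TypeD n - a == n)%N = (a.+1 == n.+1) by rewrite /=; lia.
    have -> : (dimN TypeD n - a == n.+1)%N = (a.+1 == n) by rewrite /=; lia.
    move: (a.+1) => l; have [->|n1] := eqVneq l n; first by decide_eqs; rewrite /=; ring.
    by case: eqP => _ /=; ring.
  rewrite !big_split /= !sum_indic_const; rewrite /= in hm hn.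
  by decide_ranges; rewrite /=; ring.
rewrite e2 in vv; rewrite vcoord_basis_vec hi /=; decide_eqs; rewrite /=.
by apply: (mulfI h2); rewrite vv mulr0.
Qed.

Lemma unipotent_words t n (g : 'M[F]_(dimN t n)) : (min_rank t <= n)%N ->
  g \in unipotent F t n ->
  exists w, [/\ letters_in 1 n w, (size w <= n * (12 * cost n))%N & g = wprod F t n w].
Proof.
move=> hn hg.
suff [w [lw sw ew]] : exists w, [/\ letters_in 1 n w, (size w <= n * (12 * cost n))%N
    & wprod F t n w *m g = 1%:M].
  exists (word_inv w); rewrite letters_in_inv size_word_inv; split=> //.
  by rewrite -[g]mul1mx -(wprod_inv' hn h2 lw) -mulmxA ew mulmx1.
have key d : forall j (h : 'M[F]_(dimN t n)), (j + d = n.+1 - min_rank t)%N ->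
    h \in unipotent F t n -> standard_tail j h ->
    exists w, [/\ letters_in 1 n w, (size w <= d * (12 * cost n))%N &
      wprod F t n w *m h = 1%:M].
  elim: d => [|d IH] j h hj hh hs.
    exists [::]; split=> //=; rewrite mul1mx; apply: standard_tail_eq1 => //.
    by rewrite -hj addn0.
  have [|w [lw sw ew]] := clean_column _ hh hs; first lia.
  have [||w' [lw' sw' ew']] := IH j.+1 (wprod F t n w *m h) _ _ ew; first lia.
    by rewrite unipotentM // wprod_unipotent.
  exists (w' ++ w); split; first by rewrite letters_in_cat lw' lw.
    by rewrite size_cat mulSn addnC leq_add.
  by rewrite wprod_cat -mulmxA.
have [|w [lw sw ew]] := key _ 0%N g (add0n _) hg; first exact: standard_tail0.
exists w; split=> //; apply: leq_trans sw _; rewrite leq_mul2r; apply/orP; right.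
by case: (t) => /=; lia.
Qed.

End Sweep.

(** * The lower bound n p *)

Section Abelianization.
Variable K : finFieldType.
Hypothesis h2 : 2%:R != 0 :> K.
Variables (t : classical_type) (n : nat).
Hypothesis hn : (min_rank t <= n)%N.

Definition superdiag k (g : 'M[K]_(dimN t n)) : K := vcoord (g *m basis_vec K _ k.+1) k.

Definition superdiag_scale k : K := if t is TypeC then (if k == n then 2%:R else 1) else 1.

(** In type D the entry (n, n + 1) vanishes on U, and the coordinate of the
abelianization that belongs to the last root is elsewhere; the first n - 1
entries suffice. *)
Definition superdiag_rank := if t is TypeD then n.-1 else n.

Lemma superdiag_letter j c k (g : 'M[K]_(dimN t n)) :
  (0 < j <= n)%N -> (0 < k <= superdiag_rank)%N -> g \in unipotent K t n ->
  superdiag k (simple_root_elt t n j c *m g)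
  = superdiag k g + (j == k)%:R * (c * superdiag_scale k).
Proof.
rewrite /superdiag_rank /superdiag_scale /superdiag => hj hk hg.
have kN : (0 < k.+1 <= dimN t n)%N by move: hk hn; case: (t) => /=; lia.
rewrite -mulmxA; have [] := unipotent_basis_vec hg kN.
move: (g *m _) => v {hg g}; move: v hk kN hj.
move=> v hk kN hj; move: v k hk kN; move: t n j hn hj; apply: root_cases.
- move=> m j hj v k hk kN v0 v1; rewrite vcoord_rootA // [k == j]eq_sym.
  by case: eqP => [->|_]; rewrite ?v1 /=; ring.
- move=> T m j ht hj v k hk kN v0 v1; have hN := dimN_bounds m ht.
  have kn : (k <= m)%N by case: (T) hk => /=; lia.
  rewrite vcoord_rootL // [k == j]eq_sym.
  have -> : (k == dimN T m - j)%N = false by lia.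
  have [e|_] := eqVneq j k; last by rewrite /=; ring.
  rewrite e v1; have -> : (k == m) = false by lia.
  have -> : (if T is TypeC then if false then 2%:R else 1 else 1) = 1 :> K by case: (T).
  by rewrite /=; ring.
- move=> m hm v k hk kN v0 v1; rewrite vcoord_rootB // [k == m]eq_sym.
  have -> : (k == m.+1) = false by lia.
  have [e|_] := eqVneq m k; last by rewrite /=; ring.
  by subst k; rewrite v1 (v0 m.+2) //=; ring.
- move=> m hm v k hk kN v0 v1; rewrite vcoord_rootC // [k == m]eq_sym.
  have [e|_] := eqVneq m k; last by rewrite /=; ring.
  by subst k; rewrite v1 //=; ring.
- move=> m hm v k hk kN v0 v1; rewrite vcoord_rootD // [m == k]eq_sym.
  have -> : (k == m) = false by lia.
  case: eqP => [e|_]; last by rewrite /=; ring.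
  by rewrite (v0 m.+1); [rewrite /=; ring | lia].
Qed.

Lemma superdiag_wprod w k : letters_in 1 n w -> (0 < k <= superdiag_rank)%N ->
  superdiag k (wprod K t n w)
  = superdiag_scale k * ((count_mem (k, false) w)%:R - (count_mem (k, true) w)%:R).
Proof.
move=> hw hk; elim: w hw => [_|[j b] w IH /= /andP[hj hw]].
  rewrite /superdiag mul1mx vcoord_basis_vec subrr mulr0.
  by have -> : (k == k.+1) = false; [lia | rewrite andbF].
rewrite superdiag_letter ?IH ?wprod_unipotent // !natrD !xpair_eqE.
by case: (j == k); case: b; rewrite /=; ring.
Qed.

Lemma superdiag_scale_neq0 k : superdiag_scale k != 0.
Proof. by rewrite /superdiag_scale; case: (t); rewrite ?oner_neq0 //; case: ifP;
  rewrite ?oner_neq0. Qed.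

End Abelianization.

Lemma sum_count_letters r (w : seq (nat * bool)) :
  (\sum_(k < r) (count_mem (k.+1, false) w + count_mem (k.+1, true) w) <= size w)%N.
Proof.
elim: w => [|[j b] w IH]; first by rewrite big1.
rewrite /= [X in (X <= _)%N](_ : _ = (\sum_(k < r) (j == k.+1) + 
   \sum_(k < r) (count_mem (k.+1, false) w + count_mem (k.+1, true) w))%N); last first.
  rewrite -big_split; apply: eq_bigr => k _; rewrite /= !xpair_eqE.
  by case: b; case: (j == k.+1) => /=; lia.
rewrite -addn1 addnC leq_add //.
have [/existsP[k /eqP e]|/existsPn h] := boolP [exists k : 'I_r, j == k.+1].
  rewrite (bigD1 k) //= e eqxx big1 // => l lk.
  by rewrite eqSS eq_sym val_eqE (negbTE lk).
by rewrite big1 // => k _; rewrite (negbTE (h k)).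
Qed.

Lemma abelian_lower_bound p t n l : prime p -> odd p -> (min_rank t <= n)%N ->
  (forall g, g \in unipotent 'F_p t n -> exists w,
     [/\ letters_in 1 n w, (size w <= l)%N & g = wprod 'F_p t n w]) ->
  (n * p <= 6 * l)%N.
Proof.
move=> pr op hn cov; have p2 : (2 < p)%N by move: (prime_gt1 pr) op; case: (p) => [|[|[|]]].
have h2 : 2%:R != 0 :> 'F_p.
  by rewrite -(dvdn_pcharf (pchar_Fp pr)) gtnNdvd.
pose w0 := flatten [seq nseq p./2 (k, false) | k <- iota 1 n].
have lw0 : letters_in 1 n w0.
  apply/allP => a /flatten_mapP[k]; rewrite mem_iota => hk /nseqP[-> _] /=; lia.
have cf k : (0 < k <= n)%N -> count_mem (k, false) w0 = p./2.
  move=> hk; rewrite count_flatten -map_comp sumnE big_map (bigD1_seq k) ?iota_uniq ?mem_iota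
    //=.
  rewrite count_nseq /= eqxx mul1n big1 ?addn0 // => i ik.
  by rewrite count_nseq /= xpair_eqE (negbTE ik).
have ct k : count_mem (k, true) w0 = 0%N.
  apply/eqP; rewrite -leqn0 leqNgt -has_count; apply/hasPn => a /flatten_mapP[i _ /nseqP[->
    _]].
  by rewrite /= xpair_eqE andbF.
have [w [lw sw ew]] := cov _ (wprod_unipotent hn h2 lw0).
have key k : (0 < k <= superdiag_rank t n)%N ->
    (p./2 <= count_mem (k, false) w + count_mem (k, true) w)%N.
  move=> hk; have hkn : (0 < k <= n)%N by move: hk; rewrite /superdiag_rank; case: (t); lia.
  have := superdiag_wprod h2 hn lw0 hk; rewrite ew superdiag_wprod // cf // ct subr0.
  move=> /(mulfI (superdiag_scale_neq0 h2 t n k)) /eqP; rewrite subr_eq -natrD.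
  move: (count_mem (k, false) w) (count_mem (k, true) w) => a b /eqP e.
  rewrite leqNgt; apply/negP => ab.
  (* the signed count is p./2 modulo p, so the unsigned count a + b is at least that *)
  have /eqP : a = p./2 + b %[mod p].
    by have := congr1 (@nat_of_ord _) e; rewrite !val_Fp_nat // => ->.
  have po := odd_double_half p; rewrite op in po.
  by rewrite !modn_small; lia.
have : (\sum_(k < superdiag_rank t n) p./2 <= size w)%N.
  apply: leq_trans (sum_count_letters (superdiag_rank t n) w).
  by apply: leq_sum => k _; apply: key; have := ltn_ord k; lia.
rewrite sum_nat_const card_ord => hs.
have po := odd_double_half p; rewrite op in po.
have : (n <= 2 * superdiag_rank t n)%N by move: hn; rewrite /superdiag_rank; case: (t) => /=;
  lia.
by move: hs sw; nia.
Qed.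

(** * Counting words up to commutation *)

Section Counting.
Variable K : finFieldType.
Variables (t : classical_type) (n : nat).
Hypothesis hn : (min_rank t <= n)%N.

Definition slow_descent (a b : nat * bool) := (a.1 <= b.1 + 2)%N.

(** One step of an insertion sort: a letter that would be followed by too steep a
descent commutes with its successor, and is moved past it. *)
Lemma insert_letter c a w : (0 < a.1 <= n)%N -> letters_in 1 n w ->
  slow_descent c a -> path slow_descent c w ->
  exists w', [/\ letters_in 1 n w', size w' = (size w).+1, path slow_descent c w'
    & wprod K t n w' = letter K t n a *m wprod K t n w].
Proof.
move=> ha; elim: w c => [|b w IH] c /=.
  by move=> _ ca _; exists [:: a]; rewrite /= ha ca.
move=> /andP[hb hw] ca /andP[cb bw].
have [ab|ba] := boolP (slow_descent a b).
  by exists [:: a, b & w]; rewrite /= ha hb hw ca ab bw.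
have [|w' [lw sw pw ew]] := IH b hw _ bw; first by move: ba; rewrite /slow_descent; lia.
exists (b :: w'); rewrite /= hb lw sw cb pw ew; split=> //.
rewrite !mulmxA; congr (_ *m _); apply: root_commute => //; move: ba hb ha;
  rewrite /slow_descent; lia.
Qed.

Lemma slow_normal_form w : letters_in 1 n w ->
  exists w', [/\ letters_in 1 n w', size w' = size w, path slow_descent (0%N, false) w'
    & wprod K t n w' = wprod K t n w].
Proof.
elim: w => [_|a w IH /= /andP[ha hw]]; first by exists [::].
have [w1 [l1 s1 p1 e1]] := IH hw.
have [|w2 [l2 s2 p2 e2]] := insert_letter ha l1 _ p1; first by [].
by exists w2; rewrite s2 s1 e2 e1.
Qed.

(** A bit [true] raises the current index; [false] followed by [b] emits the letter
with the current index and sign [b], then lowers the index by 2.  The index rises by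
at most n plus twice the number of letters, hence n + 4 l bits. *)
Fixpoint decode (pos : nat) (s : seq bool) : seq (nat * bool) :=
  match s with
  | true :: s' => decode pos.+1 s'
  | false :: b :: s' => (pos, b) :: decode (pos - 2) s'
  | _ => [::]
  end.

Lemma decode_shift d pos s : decode pos (nseq d true ++ s) = decode (pos + d) s.
Proof. by elim: d pos => [|d IH] pos; rewrite ?addn0 //= IH addnS. Qed.

Lemma encode c w M : letters_in 1 n w -> path slow_descent c w ->
  (n - (c.1 - 2) + 4 * size w <= M)%N ->
  exists2 s, size s = M & decode (c.1 - 2) s = w.
Proof.
elim: w c M => [|[k b] w IH] c M /=.
  move=> _ _ _; exists (nseq M true); first by rewrite size_nseq.
  by rewrite -[nseq M _]cats0 decode_shift.
move=> /andP[hk hw] /andP[ck kw] hM; rewrite /slow_descent /= in ck.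
pose d := (k - (c.1 - 2))%N.
have [|s ss es] := IH (k, b) (M - d - 2)%N hw kw; first by rewrite /= /d; lia.
exists (nseq d true ++ false :: b :: s).
  by rewrite size_cat size_nseq /= ss /d; lia.
rewrite decode_shift /=; have -> : (c.1 - 2 + d = k)%N by rewrite /d; lia.
by rewrite -[in RHS]es.
Qed.

Lemma count_words l :
  (forall g, g \in unipotent K t n -> exists w,
     [/\ letters_in 1 n w, (size w <= l)%N & g = wprod K t n w]) ->
  (#|unipotent K t n| <= 2 ^ (n + 4 * l))%N.
Proof.
move=> cov; pose f (s : (n + 4 * l).-tuple bool) := wprod K t n (decode 0 s).
have sub : unipotent K t n \subset f @: setT.
  apply/subsetP => g hg; have [w [lw sw ew]] := cov g hg.
  have [w' [lw' sw' pw' ew']] := slow_normal_form lw.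
  have [|s ss es] := @encode (0%N, false) w' (n + 4 * l) lw' pw'.
    by rewrite sw' /=; lia.
  apply/imsetP; exists (Tuple (introT eqP ss)) => //.
  by rewrite /f /= -[(0)%N]/((0%N, false).1 - 2)%N es ew' ew.
apply: leq_trans (subset_leq_card sub) _; apply: leq_trans (leq_imset_card _ _) _.
by rewrite cardsT card_tuple card_bool.
Qed.

End Counting.

(** * The order of the unipotent group *)

Section Size.
Variable K : finFieldType.

Definition entry h m (S : 'M[K]_(h, m)) (i j : nat) : K :=
  if insub i is Some a then if insub j is Some b then S a b else 0 else 0.

Lemma entryE h m (S : 'M[K]_(h, m)) (a : 'I_h) (b : 'I_m) : entry S a b = S a b.
Proof. by rewrite /entry !valK. Qed.

Lemma entry_out h m (S : 'M[K]_(h, m)) i j : ~~ ((i < h) && (j < m))%N -> entry S i j = 0.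
Proof. by rewrite /entry; case: insubP => //= a ha ea; case: insubP => //= b hb eb;
  rewrite ha hb. Qed.

Lemma card_unipotent_ge t n h m (f : 'M[K]_(h, m) -> 'M[K]_(dimN t n)) : injective f ->
  (forall S, f S \in unipotent K t n) -> (#|K| ^ (h * m) <= #|unipotent K t n|)%N.
Proof.
move=> fi fU; rewrite -card_mx -(card_codom fi); apply: subset_leq_card.
by apply/subsetP => _ /codomP[S ->].
Qed.

Definition blockA n h (S : 'M[K]_(h, n - h)) : 'M[K]_(dimN TypeA n) :=
  \matrix_(a, b) ((a == b)%:R + if (h <= b)%N then entry S a (b - h) else 0).

Lemma blockA_unipotent n h (S : 'M[K]_(h, n - h)) : blockA S \in unipotent K TypeA n.
Proof.
have z (a b : 'I_(dimN TypeA n)) : (b <= a)%N ->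
  (if (h <= b)%N then entry S a (b - h) else 0) = 0.
  by move=> ba; case: ifP => // hb; rewrite entry_out //; lia.
apply/unipotentP; split=> // [a b ba|a]; rewrite mxE z ?(ltnW ba) //.
  by case: eqP => [e|_]; [rewrite e ltnn in ba | rewrite addr0].
by rewrite eqxx addr0.
Qed.

Lemma blockA_inj n h : (h <= n)%N -> injective (@blockA n h).
Proof.
move=> hn S S' e; apply/matrixP => a b.
have ha : (a < dimN TypeA n)%N by have := ltn_ord a; rewrite /=; lia.
have hb : (h + b < dimN TypeA n)%N by have := ltn_ord b; rewrite /=; lia.
have /matrixP/(_ (Ordinal ha) (Ordinal hb)) := e; rewrite !mxE /= leq_addr addKn !entryE.
exact: addrI.
Qed.

Definition block_sign t : K := if t is TypeC then 1 else -1.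

(** The matrix on [0, n) x [0, n) with off-diagonal block [S], made symmetric in type C
and antisymmetric in types B and D: with columns counted from the right, this is what
preserving the form means for 1 + X when X maps the last n basis vectors to the span
of the first n and kills the others. *)
Definition block_entry t n h (S : 'M[K]_(h, n - h)) (i j : nat) : K :=
  (if (h <= j)%N then entry S i (j - h) else 0)
  + block_sign t * (if (h <= i)%N then entry S j (i - h) else 0).

Lemma block_entry_sym t n h (S : 'M[K]_(h, n - h)) i j :
  block_entry t S j i = block_sign t * block_entry t S i j.
Proof.
rewrite /block_entry mulrDr mulrA.
have -> : block_sign t * block_sign t = 1 by rewrite /block_sign; case: t; ring.
by rewrite mul1r addrC.
Qed.

Lemma block_entry_out t n h (S : 'M[K]_(h, n - h)) i j : (h <= n)%N ->
  ~~ ((i < n) && (j < n))%N -> block_entry t S i j = 0.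
Proof.
by move=> hn hij; rewrite /block_entry; case: leqP => h1; case: leqP => h2;
  rewrite ?entry_out ?mulr0 ?addr0 //; lia.
Qed.

Definition block_form t n h (S : 'M[K]_(h, n - h)) : 'M[K]_(dimN t n) :=
  \matrix_(a, b) ((a == b)%:R + block_entry t S a (dimN t n - b.+1)).

Lemma block_form_unipotent t n h (S : 'M[K]_(h, n - h)) : has_form t -> (h <= n)%N ->
  block_form t S \in unipotent K t n.
Proof.
move=> ht hn; have hN := dimN_bounds n ht.
have z (a b : 'I_(dimN t n)) : (b <= a)%N -> block_entry t S a (dimN t n - b.+1) = 0.
  by move=> ba; have ha := ltn_ord a; rewrite block_entry_out //; lia.
apply/unipotentP; split=> [a b ba|a|_].
- rewrite mxE z ?(ltnW ba) //.
  by case: eqP => [e|_]; [rewrite e ltnn in ba | rewrite addr0].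
- by rewrite mxE z // eqxx addr0.
pose X : 'M[K]_(dimN t n) := \matrix_(a, b) block_entry t S a (dimN t n - b.+1).
have eX : block_form t S = 1%:M + X by apply/matrixP => a b; rewrite !mxE.
pose sg (a : nat) := pairing_sign K t n a.+1.
pose F := Defs.form K t n.
have FX a b : (F *m X) a b = sg a * block_entry t S (dimN t n - a.+1) (dimN t n - b.+1).
  have ha := ltn_ord a.
  rewrite mxE (bigD1 (rev_ord a)) //= big1 ?addr0 => [|c hc]; rewrite !mxE /=.
    by have -> : (a.+1 + (dimN t n - a.+1).+1 == (dimN t n).+1)%N by lia.
  have -> : (a.+1 + c.+1 == (dimN t n).+1)%N = false; last by rewrite mul0r.
  by apply: contraNF hc => /eqP e; apply/eqP/val_inj => /=; lia.
have XF a b : (X^T *m F) a b = sg (dimN t n - b.+1)%N * block_entry t S (dimN t n - b.+1)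
  (dimN t n - a.+1).
  have hb := ltn_ord b.
  rewrite mxE (bigD1 (rev_ord b)) //= big1 ?addr0 => [|c hc]; rewrite !mxE /=.
    have -> : ((dimN t n - b.+1).+1 + b.+1 == (dimN t n).+1)%N by lia.
    by rewrite mulrC.
  have -> : (c.+1 + b.+1 == (dimN t n).+1)%N = false; last by rewrite mulr0.
  by apply: contraNF hc => /eqP e; apply/eqP/val_inj => /=; lia.
(* The image of X lies in the span of the first n basis vectors, which is isotropic. *)
have XFX : X^T *m (F *m X) = 0.
  apply/matrixP => a b; rewrite !mxE big1 // => c _; rewrite FX !mxE.
  have hc := ltn_ord c; have [cn|nc] := ltnP c n.
    by rewrite [X in _ * (_ * X)]block_entry_out ?mulr0 ?mulr0 //; lia.
  by rewrite block_entry_out ?mul0r //; lia.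
have XFFX : X^T *m F + F *m X = 0.
  apply/matrixP => a b; rewrite [LHS]mxE XF FX [RHS]mxE [block_entry t S (_ - a.+1)%N
    _]block_entry_sym.
  have ha := ltn_ord a; have hb := ltn_ord b.
  have [hij|hij] := boolP ((dimN t n - b.+1 < n) && (dimN t n - a.+1 < n))%N; last first.
    by rewrite block_entry_out // !mulr0 addr0.
  have -> : sg (dimN t n - b.+1)%N = 1.
    rewrite /sg /pairing_sign; have -> : (dimN t n - b.+1 < n)%N by lia.
    by case: (t).
  have sgE : sg a * block_sign t = -1.
    rewrite /sg /pairing_sign /block_sign; have -> : (a < n)%N = false by lia.
    by case: (t); ring.
  by rewrite mulrA sgE mulN1r mul1r subrr.
have trX : (1%:M + X)^T = 1%:M + X^T by apply/matrixP => a b; rewrite !mxE eq_sym.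
apply/eqP; rewrite eX trX mulmxDl mul1mx mulmxDr mulmx1 mulmxDl -/F -!mulmxA XFX addr0.
by rewrite -addrA XFFX addr0.
Qed.

Lemma block_form_inj t n h : has_form t -> (h <= n)%N -> injective (@block_form t n h).
Proof.
move=> ht hn S S' e; apply/matrixP => a b; have hN := dimN_bounds n ht.
have la := ltn_ord a; have lb := ltn_ord b.
have ha : (a < dimN t n)%N by lia.
have hb : (dimN t n - (h + b).+1 < dimN t n)%N by lia.
have /matrixP/(_ (Ordinal ha) (Ordinal hb)) := e; rewrite !mxE /=.
rewrite subnSK ?subKn; try lia.
rewrite /block_entry leq_addr addKn !entryE; have -> : (h <= a)%N = false by lia.
by rewrite mulr0 !addr0 => /addrI.
Qed.

Lemma unipotent_card t n : (min_rank t <= n)%N ->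
  (#|K| ^ (n./2 * (n - n./2)) <= #|unipotent K t n|)%N.
Proof.
move=> _; have hn : (n./2 <= n)%N by lia.
have [ht|] := boolP (has_form t).
  by apply: card_unipotent_ge (block_form_inj ht hn) _ => S; apply: block_form_unipotent.
by case: t => // _; apply: card_unipotent_ge (blockA_inj hn) (@blockA_unipotent n _).
Qed.

End Size.

(** * The diameter *)

Lemma covered_by_lettersP (K : finFieldType) t n l :
  covered_by_words (unipotent K t n) (simple_generators K t n) l <->
  forall g, g \in unipotent K t n ->
    exists w, [/\ letters_in 1 n w, (size w <= l)%N & g = wprod K t n w].
Proof.
split=> cov g hg; have [w] := cov g hg.
  move=> [sw hw ->]; suff [w' [lw' sw' ew']] : exists w', [/\ letters_in 1 n w',
      size w' = size w & map (letter K t n) w' = w].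
    by exists w'; rewrite sw' wprodE ew'.
  elim: w {sw} hw => [_|x w IH hw]; first by exists [::].
  have [|w' [lw' sw' ew']] := IH; first by move=> y yw; rewrite hw // in_cons yw orbT.
  have [a ha ea] : exists2 a, (0 < a.1 <= n)%N & letter K t n a = x.
    have := hw x (mem_head _ _); rewrite inE => /orP[] /imsetP[k _ ->].
      by exists (k.+1, false); rewrite //= ltn_ord.
    by exists (k.+1, true); rewrite //= ltn_ord.
  by exists (a :: w'); rewrite /= ha lw' sw' ew' ea.
move=> [lw sw ->]; exists (map (letter K t n) w); rewrite size_map -wprodE; split=> //.
move=> x /mapP[[k b] /(allP lw) /= hk ->]; rewrite inE.
case: k hk => // k hk; apply/orP; case: b; [right|left];
  by apply/imsetP; exists (Ordinal hk).
Qed.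

Lemma is_diameter_exists (A : pzSemiRingType) (H S : {pred A}) l : (0 < l)%N ->
  covered_by_words H S l -> exists2 d, is_diameter H S d & (d <= l)%N.
Proof.
move=> l0 cov; have ex : exists d, (0 < d)%N && `[< covered_by_words H S d >].
  by exists l; rewrite l0; apply/asboolP.
case: (ex_minnP ex) => d /andP[d0 /asboolP dcov] dmin; exists d.
  by split=> // m m0 mcov; apply: dmin; rewrite m0; apply/asboolP.
by apply: dmin; rewrite l0; apply/asboolP.
Qed.

Section Estimates.
Variable R : realType.

Lemma trunc_log2_ln p : (1 < p)%N -> (trunc_log 2 p)%:R * ln 2%:R <= ln p%:R :> R.
Proof.
move=> hp; rewrite mulr_natl -lnXn // ler_ln ?posrE ?exprn_gt0 ?ltr0n //; last by lia.
by rewrite -natrX ler_nat trunc_logP //; lia.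
Qed.

Lemma diameter_upper_estimate p n d : (2 < p)%N ->
  (d <= n * (12 * chain_cost p (trunc_log 2 p).+1 n))%N ->
  d%:R <= (288%:R / ln 2%:R + 96%:R) * (n%:R * p%:R + n%:R ^+ 2 * ln p%:R) :> R.
Proof.
move=> hp hd; set T := trunc_log 2 p in hd.
have T1 : (0 < T)%N by rewrite trunc_log_gt0; lia.
have l2 : 0 < ln 2%:R :> R by rewrite ln_gt0 // ltr1n.
have lp : 0 <= ln p%:R :> R by rewrite ln_ge0 // ler1n; lia.
have hT : T%:R <= ln p%:R / ln 2%:R :> R by rewrite ler_pdivlMr // trunc_log2_ln //; lia.
have : (d <= 288 * (n * n) * T + 96 * (n * p))%N.
  by apply: leq_trans hd _; rewrite /chain_cost; nia.
rewrite -(ler_nat R) natrD !natrM -(expr2 n%:R) => /le_trans; apply.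
have n2 : 0 <= n%:R ^+ 2 :> R by rewrite exprn_ge0.
have np : 0 <= n%:R * p%:R :> R by rewrite mulr_ge0.
have a : 288%:R * n%:R ^+ 2 * T%:R <= 288%:R / ln 2%:R * (n%:R ^+ 2 * ln p%:R) :> R.
  have -> : 288%:R / ln 2%:R * (n%:R ^+ 2 * ln p%:R) = 288%:R * n%:R ^+ 2 * (ln p%:R / ln
    2%:R) :> R.
    by field; rewrite gt_eqF.
  by rewrite ler_wpM2l // mulr_ge0.
have b : 0 <= 288%:R / ln 2%:R * (n%:R * p%:R) :> R by rewrite !mulr_ge0 // invr_ge0 ltW.
have c : 0 <= n%:R ^+ 2 * ln p%:R :> R by rewrite mulr_ge0.
move: a b c; set u := 288%:R / _; set x := n%:R * p%:R; set y := _ * ln _.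
move: (288%:R * _ * _) => z a b c; rewrite !mulrDl !mulrDr; lra.
Qed.

(** For n = 1 the exponent in the second hypothesis is 0, but then n^2 log p is
dominated by n p. *)
Lemma diameter_lower_estimate p n d : (2 < p)%N -> (0 < n)%N -> (n * p <= 6 * d)%N ->
  (p ^ (n./2 * (n - n./2)) <= 2 ^ (n + 4 * d))%N ->
  66%:R^-1 * (n%:R * p%:R + n%:R ^+ 2 * ln p%:R) <= d%:R :> R.
Proof.
move=> hp hn h1 h2.
have lp : 0 <= ln p%:R :> R by rewrite ln_ge0 // ler1n; lia.
have l21 : ln 2%:R <= 1 :> R.
  by have := @le_ln1Dx R 1; rewrite -(natrD _ 1 1) => -> //; lra.
have l2 : 0 < ln 2%:R :> R by rewrite ln_gt0 // ltr1n.
have H1 : n%:R * p%:R <= 6%:R * d%:R :> R by rewrite -!natrM ler_nat.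
suff H2 : n%:R ^+ 2 * ln p%:R <= 60%:R * d%:R :> R.
  by rewrite ler_pdivrMl //; lra.
have [e|n2] := eqVneq n 1%N.
  rewrite e expr1n mul1r; rewrite e mul1r in H1.
  have := @ln_sublinear R p%:R; rewrite ltr0n => /(_ (ltnW (ltnW hp))) h.
  by have : 0 <= d%:R :> R := ler0n _ _; lra.
have H3 : (n./2 * (n - n./2))%:R * ln p%:R <= (n + 4 * d)%:R * ln 2%:R :> R.
  rewrite !mulr_natl -!lnXn ?ltr0n //; last by lia.
  by rewrite ler_ln ?posrE ?exprn_gt0 ?ltr0n -?natrX ?ler_nat //; lia.
have H4 : n%:R ^+ 2 <= 6%:R * (n./2 * (n - n./2))%:R :> R.
  rewrite -natrX -natrM ler_nat -mulnn; have := odd_double_half n.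
  by case: (odd n) => /=; nia.
have H5 : (n + 4 * d)%:R * ln 2%:R <= 10%:R * d%:R :> R.
  apply: (@le_trans _ _ ((n + 4 * d)%:R * 1)); first by rewrite ler_wpM2l.
  by rewrite mulr1 -natrM ler_nat; nia.
apply: le_trans (ler_wpM2r lp H4) _; rewrite -mulrA.
by move: (_ * ln p%:R) H3 => z; lra.
Qed.

End Estimates.

Theorem theorem1p1 (R : realType) :
  exists c C : R, [/\ 0 < c, 0 < C &
    forall (p n : nat) (t : classical_type),
      prime p -> odd p -> (min_rank t <= n)%N ->
      exists d : nat,
        [/\ is_diameter (unipotent 'F_p t n) (simple_generators 'F_p t n) d,
            c * (n%:R * p%:R + n%:R ^+ 2 * ln p%:R) <= d%:R
          & d%:R <= C * (n%:R * p%:R + n%:R ^+ 2 * ln p%:R)]].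
Proof.
exists 66%:R^-1, (288%:R / ln 2%:R + 96%:R); split.
- by rewrite invr_gt0.
- by rewrite addr_gt0 // divr_gt0 // ln_gt0 // ltr1n.
move=> p n t pr op hn.
have p2 : (2 < p)%N by move: (prime_gt1 pr) op; case: (p) => [|[|[|]]].
have n0 : (0 < n)%N by move: hn; case: (t) => /=; lia.
have h2 : 2%:R != 0 :> 'F_p by rewrite -(dvdn_pcharf (pchar_Fp pr)) gtnNdvd.
have hL : (p < 2 ^ (trunc_log 2 p).+1)%N by rewrite trunc_log_ltn.
have [||d dd dl] := @is_diameter_exists _ (mem (unipotent 'F_p t n)) (mem (simple_generators
  'F_p t n))
    (n * (12 * chain_cost p (trunc_log 2 p).+1 n)).
- by rewrite /chain_cost !muln_gt0 n0 /=; lia.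
- by apply/covered_by_lettersP => g hg; apply: unipotent_words.
have [_ /covered_by_lettersP dcov _] := dd.
exists d; split=> //; last exact: diameter_upper_estimate.
apply: diameter_lower_estimate => //; first exact: abelian_lower_bound dcov.
have := leq_trans (unipotent_card 'F_p hn) (count_words hn dcov).
by rewrite card_Fp.
Qed.
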